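(* For every $c\in\mathbb{C}$ with $c\ne-\frac{22}{5}$ and every $(h,w)\in\mathbb{C}^2$ there exists an up to isomorphism unique lowest weight representation of the $\mathcal{W}_3$-algebra with central charge $c$, lowest weight $(h,w)$ and lowest weight vector $\Psi$ in which the vectors $$L_{m_1}\cdots L_{m_r}W_{n_1}\cdots W_{n_s}\Psi,\qquad r,s\ge0,\quad m_1\le\cdots\le m_r<0,\quad n_1\le\cdots\le n_s<0,$$ form a basis (a Verma representation). This representation admits a unique twisted-invariant bilinear form $(\cdot,\cdot)$ with $(\Psi,\Psi)=1$, and this form is automatically symmetric. If in addition $c,h,w\in\mathbb{R}$, then this representation also admits a unique invariant sesquilinear form $\langle\cdot,\cdot\rangle$ with $\langle\Psi,\Psi\rangle=1$, and this form is automatically Hermitian.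
   Context: Let $V$ be a complex vector space. A formal series $\sum_{n\in\mathbb{Z}}A_n z^{-n}$ with $A_n\in\mathrm{End}(V)$ is a field on $V$ if for every $v\in V$ there is $n_v$ with $A_nv=0$ for all $n\ge n_v$. A representation of the $\mathcal{W}_3$-algebra with central charge $c\in\mathbb{C}$, $c\ne-\frac{22}{5}$, on $V$ consists of linear operators $\{L_n,W_n\}_{n\in\mathbb{Z}}$ on $V$ such that $L(z)=\sum_n L_nz^{-n-2}$ and $W(z)=\sum_n W_nz^{-n-3}$ are fields and, for all $m,n\in\mathbb{Z}$, $$[L_m,L_n]=(m-n)L_{m+n}+\tfrac{c}{12}m(m^2-1)\delta_{m+n,0},\qquad [L_m,W_n]=(2m-n)W_{m+n},$$ $$[W_m,W_n]=\tfrac{c}{3\cdot5!}(m^2-4)(m^2-1)m\,\delta_{m+n,0}+b^2(m-n)\Lambda_{m+n}+\tfrac{1}{30}(m-n)(2m^2-mn+2n^2-8)L_{m+n},$$ where $b^2=\frac{16}{22+5c}$ and $\Lambda_n=\sum_{k>-2}L_{n-k}L_k+\sum_{k\le-2}L_kL_{n-k}-\frac{3}{10}(n+2)(n+3)L_n$. A nonzero vector $\Psi$ is a lowest weight vector with lowest weight $(h,w)\in\mathbb{C}^2$ if $L_n\Psi=W_n\Psi=0$ for all $n>0$, $L_0\Psi=h\Psi$ and $W_0\Psi=w\Psi$. The representation is a lowest weight representation if it has a cyclic lowest weight vector (the smallest subspace containing it and invariant under all $L_n,W_n$ is $V$). A bilinear form $(\cdot,\cdot)$ on $V$ is twisted-invariant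 if $(L_nx,y)=(x,L_{-n}y)$ and $(W_nx,y)=(x,W_{-n}y)$ for all $x,y\in V$, $n\in\mathbb{Z}$; it is symmetric if $(x,y)=(y,x)$. A sesquilinear form $\langle\cdot,\cdot\rangle$ is invariant if $\langle L_nx,y\rangle=\langle x,L_{-n}y\rangle$ and $\langle W_nx,y\rangle=\langle x,W_{-n}y\rangle$ for all $x,y\in V$, $n\in\mathbb{Z}$; it is Hermitian if $\langle x,y\rangle=\overline{\langle y,x\rangle}$. *)

(* Defs.v *)
From HB Require Import structures.
From mathcomp Require Import all_boot all_order all_algebra.
From mathcomp Require Import sesquilinear.
From mathcomp Require Import boolp classical_sets functions cardinality fsbigop reals.
From mathcomp Require Import complex.

Set Implicit Arguments.
Unset Strict Implicit.
Unset Printing Implicit Defensive.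

Import Order.TTheory GRing.Theory Num.Theory.
Local Open Scope classical_set_scope.
Local Open Scope ring_scope.

(* [A m] is the coefficient of z^{-m}. *)
Definition is_field (R : realType) (V : lmodType R[i])
    (A : int -> {linear V -> V}) : Prop :=
  forall v : V, exists nv : int, forall n : int, nv <= n -> A n v = 0.

(* The sums are finitely supported as soon as [fun n => L n] is a field
   (up to a shift of the index); [\sum_(k \in _)] is 0 on infinite support. *)
Definition Lambda (R : realType) (V : lmodType R[i])
    (L : int -> {linear V -> V}) (n : int) (v : V) : V :=
  \sum_(k \in [set k : int | - 2 < k]) L (n - k) (L k v)
  + \sum_(k \in [set k : int | k <= - 2]) L k (L (n - k) v)
  - (3 / 10 * ((n + 2) * (n + 3))%:~R) *: L n v.

(* The square of the constant b of the commutation relations. *)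
Definition b2 (R : realType) (c : R[i]) : R[i] := 16 / (22 + 5 * c).

(* The shifts in the first two clauses come from
   L(z) = \sum_n L_n z^{-n-2} and W(z) = \sum_n W_n z^{-n-3}. *)
Record W3_representation (R : realType) (c : R[i]) (V : lmodType R[i])
    (L W : int -> {linear V -> V}) : Prop := {
  W3_L_field : is_field (fun m => L (m - 2));
  W3_W_field : is_field (fun m => W (m - 3));
  W3_LL : forall (m n : int) (v : V),
    L m (L n v) - L n (L m v) =
      (m - n)%:~R *: L (m + n) v
      + (c / 12 * (m * (m ^+ 2 - 1))%:~R * (m + n == 0)%:R) *: v;
  W3_LW : forall (m n : int) (v : V),
    L m (W n v) - W n (L m v) = (2 * m - n)%:~R *: W (m + n) v;
  W3_WW : forall (m n : int) (v : V),
    W m (W n v) - W n (W m v) =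
      (c / (3 * (5`!)%:R) * ((m ^+ 2 - 4) * (m ^+ 2 - 1) * m)%:~R
         * (m + n == 0)%:R) *: v
      + (b2 c * (m - n)%:~R) *: Lambda L (m + n) v
      + (1 / 30 * ((m - n) * (2 * m ^+ 2 - m * n + 2 * n ^+ 2 - 8))%:~R)
          *: L (m + n) v
}.

Record lowest_weight_vector (R : realType) (V : lmodType R[i])
    (L W : int -> {linear V -> V}) (h w : R[i]) (Psi : V) : Prop := {
  lwv_neq0 : Psi <> 0;
  lwv_Lpos : forall n : int, 0 < n -> L n Psi = 0;
  lwv_Wpos : forall n : int, 0 < n -> W n Psi = 0;
  lwv_L0 : L 0 Psi = h *: Psi;
  lwv_W0 : W 0 Psi = w *: Psi
}.

Definition is_subspace (R : realType) (V : lmodType R[i]) (S : set V) : Prop :=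
  S 0 /\ forall (a : R[i]) (u v : V), S u -> S v -> S (a *: u + v).

Definition cyclic_vector (R : realType) (V : lmodType R[i])
    (L W : int -> {linear V -> V}) (Psi : V) : Prop :=
  forall S : set V, is_subspace S ->
    (forall (n : int) (v : V), S v -> S (L n v)) ->
    (forall (n : int) (v : V), S v -> S (W n v)) ->
    S Psi -> S = setT.

Definition is_basis (R : realType) (V : lmodType R[i]) (I : eqType)
    (e : I -> V) : Prop :=
  (forall (s : seq I) (a : I -> R[i]), uniq s ->
     \sum_(i <- s) a i *: e i = 0 -> forall i, i \in s -> a i = 0) /\
  (forall v : V, exists (s : seq I) (a : I -> R[i]),
     v = \sum_(i <- s) a i *: e i).

Definition neg_nondecreasing (s : seq int) : bool :=
  sorted <=%R s && all (fun n : int => n < 0) s.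

(* Pairs ((m_1, ..., m_r), (n_1, ..., n_s)). *)
Definition pbw_index : Type :=
  {p : seq int * seq int | neg_nondecreasing p.1 && neg_nondecreasing p.2}.

(* L_{m_1} ... L_{m_r} W_{n_1} ... W_{n_s} Psi *)
Definition pbw_vector (R : realType) (V : lmodType R[i])
    (L W : int -> {linear V -> V}) (Psi : V) (p : pbw_index) : V :=
  foldr (fun m v => L m v) (foldr (fun n v => W n v) Psi (val p).2) (val p).1.

Record Verma_representation (R : realType) (c h w : R[i]) (V : lmodType R[i])
    (L W : int -> {linear V -> V}) (Psi : V) : Prop := {
  Verma_rep : W3_representation c L W;
  Verma_lwv : lowest_weight_vector L W h w Psi;
  Verma_cyclic : cyclic_vector L W Psi;
  Verma_basis : is_basis (pbw_vector L W Psi)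
}.

(* Isomorphism of representations with a distinguished vector. *)
Definition isomorphic (R : realType)
    (V : lmodType R[i]) (L W : int -> {linear V -> V}) (Psi : V)
    (V' : lmodType R[i]) (L' W' : int -> {linear V' -> V'}) (Psi' : V') : Prop :=
  exists phi : {linear V -> V'},
    [/\ bijective phi,
        forall (n : int) (v : V), phi (L n v) = L' n (phi v),
        forall (n : int) (v : V), phi (W n v) = W' n (phi v)
      & phi Psi = Psi'].

(* Sesquilinear forms are linear in the first and antilinear in the second
   argument. The statements about them are insensitive to this choice, as
   exchanging the two arguments preserves invariance. *)
Notation "{ 'sesquilinear_form' V }" :=
  {bilinear V -> V -> _ | *%R & Num.conj \; *%R}
  (format "{ 'sesquilinear_form'  V }") : ring_scope.

(* Called twisted invariance for bilinear forms and invariance for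
   sesquilinear forms. *)
Definition invariant_form (R : realType) (V : lmodType R[i])
    (L W : int -> {linear V -> V}) (f : V -> V -> R[i]) : Prop :=
  forall (n : int) (x y : V),
    f (L n x) y = f x (L (- n) y) /\ f (W n x) y = f x (W (- n) y).

Definition form_symmetric (R : realType) (V : lmodType R[i])
    (f : V -> V -> R[i]) : Prop :=
  forall x y : V, f x y = f y x.

Definition form_hermitian (R : realType) (V : lmodType R[i])
    (f : V -> V -> R[i]) : Prop :=
  forall x y : V, f x y = Num.conj (f y x).

(* Main.v *)
Require Import Defs.
From HB Require Import structures.
From mathcomp Require Import all_boot all_order all_algebra.
From mathcomp Require Import sesquilinear.
From mathcomp Require Import boolp classical_sets functions cardinality fsbigop reals.
From mathcomp Require Import complex.
From mathcomp Require Import zify ring.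
From mathcomp Require monalg.

Import Order.TTheory GRing.Theory Num.Theory.
Local Open Scope ring_scope.

Set Implicit Arguments.
Unset Strict Implicit.
Unset Printing Implicit Defensive.

(** A vector of a lowest weight representation is a combination of words in the
    letters [L_n], [W_n] applied to the lowest weight vector, so everything is
    expressed through functions [f] from words to a module. Such an [f] is
    called a solution if [f (u x y v) - f (u y x v)] is the value of [f] on
    [u [x, y] v], and if a final letter of nonnegative mode acts on the lowest
    weight vector as it should. Word evaluation in a representation is a
    solution, with values in the representation.

    Existence of the Verma representation is a PBW theorem: the values of a
    solution on the sorted words in letters of negative mode can be prescribed
    arbitrarily, in one way only ([solution_exists], [eq_solution]). Counting
    [L_n] once and [W_n] twice, a bracket has smaller weight than the product
    of its letters, even though [W_m, W_n] is quadratic in the [L_k]; so one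
    constructs a solution weight by weight. At a given weight the required
    difference between a word and the word with two neighbours exchanged is
    already known, and the question is whether these differences come from a
    potential. Insertion sort defines one, and it is the right one
    ([sort_cost_swap]) as soon as the differences are antisymmetric, commute for
    disjoint exchanges, and satisfy the hexagon relation for three neighbours.
    The hexagon is the Jacobi identity ([jacobi]). Its only nontrivial cases are
    [L, W, W], which holds because [Lambda] is quasi-primary and
    [b^2 (22 + 5 c) = 16] ([Lambda_L]), and [W, W, W], where the normally
    ordered products [L_k W_(N-k)] cancel in the cyclic sum and a polynomial
    identity remains ([Lambda_W]). The infinite sums are finite on every vector,
    because a solution vanishes on words with a final segment of positive degree
    ([solution_deg_gt0]).

    The free module on the PBW indices then carries the representation: a letter
    [x] sends the basis vector of a word [w] to the value at [x w] of the
    solution given by the basis. Since a solution is determined by its values on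
    PBW words, every solution factors through every Verma representation
    ([Verma_lift]); uniqueness up to isomorphism is a special case.

    For the forms, let [omega w] be the coefficient of the lowest weight vector
    in the vector of the word [w], and let [adjoint] reverse a word and negate
    its modes. An invariant form is necessarily
    [(u Psi, v Psi) = omega (adjoint u ++ v)] ([form_on_words]). This expression
    is a solution in [u] and in [v], because [adjoint] respects the brackets
    ([bracket_adjoint]) and [omega] is lowest weight for the adjoint action
    ([omega_head]); hence the form exists. Symmetry is
    [omega (adjoint w) = omega w], and in the real case [omega] is real, so the
    same argument applies to sesquilinear forms, with complex conjugation in
    place of the identity. *)

(** * Linear identities in modules *)

(** Formal linear combinations of numbered atoms: an identity between two of
    them can be checked coefficient by coefficient, where [ring] and [field]
    apply. *)
Inductive linexp (K : Type) :=
  | LinVar of nat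
  | LinZero
  | LinAdd of linexp K & linexp K
  | LinOpp of linexp K
  | LinScale of K & linexp K.
Arguments LinVar {K}.
Arguments LinZero {K}.

Section Linexp.
Variables (K : comNzRingType) (V : lmodType K).

Fixpoint lin_eval (env : seq V) (e : linexp K) : V :=
  match e with
  | LinVar i => nth 0 env i
  | LinZero => 0
  | LinAdd e1 e2 => lin_eval env e1 + lin_eval env e2
  | LinOpp e1 => - lin_eval env e1
  | LinScale a e1 => a *: lin_eval env e1
  end.

Fixpoint lin_coef (e : linexp K) (i : nat) : K :=
  match e with
  | LinVar j => if eqn j i then 1 else 0
  | LinZero => 0
  | LinAdd e1 e2 => lin_coef e1 i + lin_coef e2 i
  | LinOpp e1 => - lin_coef e1 i
  | LinScale a e1 => a * lin_coef e1 i
  end.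

Lemma lin_coef_var j i : lin_coef (LinVar j) i = (j == i)%:R.
Proof. by rewrite /= -[eqn j i]/(j == i); case: (j == i). Qed.

Lemma lin_evalE env e :
  lin_eval env e = \sum_(i < size env) lin_coef e i *: nth 0 env i.
Proof.
elim: e => [j||e1 IH1 e2 IH2|e1 IH1|a e1 IH1].
- under eq_bigr do rewrite lin_coef_var; case: (ltnP j (size env)) => [lt_j|ge_j] /=.
    rewrite (bigD1 (Ordinal lt_j)) //= eqxx scale1r big1 ?addr0 // => i.
    by rewrite -val_eqE /= eq_sym => /negbTE->; rewrite scale0r.
  rewrite nth_default // big1 // => i _; rewrite gtn_eqF ?scale0r //.
  exact: leq_trans (ltn_ord i) ge_j.
- by rewrite /= big1 // => i _; rewrite scale0r.
- by rewrite /= IH1 IH2 -big_split; apply: eq_bigr => i _; rewrite scalerDl.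
- by rewrite /= IH1 -sumrN; apply: eq_bigr => i _; rewrite scaleNr.
- by rewrite /= IH1 scaler_sumr; apply: eq_bigr => i _; rewrite scalerA.
Qed.

Fixpoint lin_coef_eq (n : nat) (e1 e2 : linexp K) : Prop :=
  if n is n'.+1 then lin_coef e1 n' = lin_coef e2 n' /\ lin_coef_eq n' e1 e2
  else True.

Lemma lin_eval_eq env e1 e2 :
  lin_coef_eq (size env) e1 e2 -> lin_eval env e1 = lin_eval env e2.
Proof.
move=> E; rewrite !lin_evalE; apply: eq_bigr => i _; congr (_ *: _).
elim: (size env) E (i : nat) (ltn_ord i) => //= n IH [En /IH{}IH] j.
by rewrite ltnS leq_eqVlt => /orP[/eqP->|/IH].
Qed.
End Linexp.

(* Atoms are compared up to conversion: the same sum of integers may be built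
   from different instances. *)
Ltac lin_index t env :=
  lazymatch env with
  | cons ?u ?env' =>
      match goal with
      | _ => let _ := match goal with _ => constr_eq t u end in constr:(O)
      | _ => let i := lin_index t env' in constr:(S i)
      | _ => let _ := match goal with _ => unify t u end in constr:(O)
      end
  end.
Ltac lin_mem t env :=
  match goal with
  | _ => let _ := lin_index t env in constr:(true)
  | _ => constr:(false)
  end.
Ltac lin_atoms t env :=
  lazymatch t with
  | GRing.add ?a ?b => let env' := lin_atoms a env in lin_atoms b env'
  | GRing.opp ?a => lin_atoms a env
  | GRing.zero => env
  | GRing.scale _ ?a => lin_atoms a env
  | _ => lazymatch lin_mem t env with true => env | false => constr:(cons t env) end
  end.
Ltac lin_reify K t env :=
  lazymatch t with
  | GRing.add ?a ?b =>
      let x := lin_reify K a env in let y := lin_reify K b env in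
      constr:(@LinAdd K x y)
  | GRing.opp ?a => let x := lin_reify K a env in constr:(@LinOpp K x)
  | GRing.zero => constr:(@LinZero K)
  | GRing.scale ?k ?a => let x := lin_reify K a env in constr:(@LinScale K k x)
  | _ => let i := lin_index t env in constr:(@LinVar K i)
  end.
(** Reduces an equality in a module over [K] to the equalities of the
    coefficients of its atoms. *)
Ltac lin_split K :=
  lazymatch goal with
  | |- @eq ?V ?a ?b =>
      let env0 := lin_atoms a constr:(@nil V) in
      let env := lin_atoms b env0 in
      let x := lin_reify K a env in
      let y := lin_reify K b env in
      refine (@lin_eval_eq _ _ env x y _);
      cbn [lin_coef_eq lin_coef size eqn];
      repeat match goal with |- _ /\ _ => split end; try exact I
  end.

(** Adds a multiple of a known equation to the goal, so that the goal becomes an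
    identity between formal linear combinations. *)
Lemma lin_use (K : comNzRingType) (V : lmodType K) (k : K) (u v x y : V) :
  x = y -> u = v + k *: (x - y) -> u = v.
Proof. by move=> -> ->; rewrite subrr scaler0 addr0. Qed.
Arguments lin_use {K V} k {u v x y} _ _.

(** * Potentials on words: the coherence argument behind the PBW theorem *)

Section SwapPotential.

Variables (A : eqType) (le : rel A).

Fixpoint ins x s :=
  if s is y :: s' then if le x y then x :: s else y :: ins x s' else [:: x].

Definition isort := foldr ins [::].

Lemma perm_ins x s : perm_eq (ins x s) (x :: s).
Proof.
elim: s => //= y s IH; case: ifP => // _.
rewrite (perm_trans (_ : perm_eq _ (y :: x :: s))) ?perm_cons //.
by apply/permPl/(perm_catCA [:: y] [:: x] s).
Qed.

Lemma perm_isort s : perm_eq (isort s) s.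
Proof. by elim: s => //= x s IH; rewrite (perm_trans (perm_ins _ _)) ?perm_cons. Qed.

Lemma isort_id s : sorted le s -> isort s = s.
Proof.
elim: s => // x [|y s] IH //= /andP[xy ys].
by move: (IH ys) => /= -> /=; rewrite xy.
Qed.

Lemma perm_adjacent_swap (s1 : seq A) x y s2 :
  perm_eq (s1 ++ x :: y :: s2) (s1 ++ y :: x :: s2).
Proof. by rewrite perm_cat2l; apply/permPl/(perm_catCA [:: x] [:: y] s2). Qed.

(** Neighbouring transpositions generate all permutations. *)
Lemma perm_adjacent (P : seq A -> Prop) :
  (forall s1 x y s2, P (s1 ++ x :: y :: s2) -> P (s1 ++ y :: x :: s2)) ->
  forall s t, perm_eq s t -> P s -> P t.
Proof.
move=> Pswap s t st; rewrite -[s]cat0s -[t]cat0s; move: [::] => a.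
elim: t s a st => [|y t IH] s a st; first by rewrite (perm_nilP st).
have /path.splitPr sE : y \in s by rewrite (perm_mem st) mem_head.
case: sE st => s1 s2 st Ps.
have {}Ps : P (a ++ y :: s1 ++ s2).
  elim/last_ind: s1 s2 Ps {st} => // s1 z IHs s2.
  by rewrite !cat_rcons => Ps; apply: IHs; rewrite catA; apply: Pswap; rewrite -catA.
rewrite -cat_rcons; apply: (IH (s1 ++ s2)); last by rewrite cat_rcons.
by rewrite -(perm_cons y) -(permPr st) -[y :: _]cat1s -[y :: s2]cat1s perm_catCA.
Qed.

Hypotheses (le_total : total le) (le_trans : transitive le)
  (le_anti : antisymmetric le).

Lemma ins_sorted x s : sorted le s -> sorted le (ins x s).
Proof.
case: s => //= y s; elim: s y => [|z s IH] y /=.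
  by move=> _; case: ifP => /= [->//|xy]; case/orP: (le_total x y); rewrite ?xy // => ->.
case/andP=> yz zs; case: ifP => /= [->|xy]; first by rewrite yz.
have := IH z zs; case: ifP => //= xz.
  by case/andP=> _ ->; rewrite xz; case/orP: (le_total x y); rewrite ?xy // => ->.
by rewrite yz.
Qed.

Lemma isort_sorted s : sorted le (isort s).
Proof. by elim: s => //= x s; exact: ins_sorted. Qed.

Lemma nle_le x y : ~~ le x y -> le y x.
Proof. by case/orP: (le_total x y) => ->. Qed.

Lemma nle_trans x y z : ~~ le x y -> le z y -> ~~ le x z.
Proof. by move=> xy zy; apply: contra xy => xz; apply: le_trans zy. Qed.

Lemma ins_comm x y s : ins x (ins y s) = ins y (ins x s).
Proof.
wlog xy : x y / ~~ le x y.
  move=> H; case xy : (le x y); last by apply: H; rewrite xy.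
  case yx : (le y x); last by apply/esym/H; rewrite yx.
  by rewrite (@le_anti x y) ?xy.
have yx := nle_le xy; elim: s => [|z s IH] /=; first by rewrite (negbTE xy) yx.
case yz : (le y z) => /=.
  rewrite (negbTE xy); case: ifP => /= xz; first by rewrite yx.
  by rewrite yz.
have zx := nle_trans xy (nle_le (negbT yz)); rewrite (negbTE zx) /= yz.
by rewrite IH.
Qed.

Lemma isort_swap s1 x y s2 : isort (s1 ++ x :: y :: s2) = isort (s1 ++ y :: x :: s2).
Proof. by elim: s1 => [|z s1 IH] /=; rewrite ?IH // ins_comm. Qed.

Lemma isort_perm s t : perm_eq s t -> isort s = isort t.
Proof.
move=> st; apply: (perm_adjacent (P := fun t => isort s = isort t) _ st) => //.
by move=> s1 x y s2 ->; exact: isort_swap.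
Qed.

(** [delta u x y v] is the prescribed difference between the values of a
    function at [u x y v] and at [u y x v]. The last two conditions express that
    a sequence of exchanges which returns to the initial word has total
    difference zero, for two disjoint exchanges (a square) and for three
    neighbouring letters (a hexagon). *)
Variables (K : comNzRingType) (M : lmodType K) (delta : seq A -> A -> A -> seq A -> M).
Hypothesis delta_anti : forall u x y v, delta u x y v = - delta u y x v.
Hypothesis delta_diag : forall u x v, delta u x x v = 0.
Hypothesis delta_far : forall u x y v z t r,
  delta u x y (v ++ z :: t :: r) - delta u x y (v ++ t :: z :: r) =
  delta (u ++ x :: y :: v) z t r - delta (u ++ y :: x :: v) z t r.
Hypothesis delta_braid : forall u x y z v,
  delta u x y (z :: v) + delta (rcons u y) x z v + delta u y z (x :: v) =
  delta (rcons u x) y z v + delta u x z (y :: v) + delta (rcons u z) x y v.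

(** Total difference accumulated while insertion sort moves [x] to its place in
    [s], respectively sorts [s], behind the prefix [u]. *)
Fixpoint ins_cost u x s :=
  if s is y :: s' then
    if le x y then 0 else delta u x y s' + ins_cost (rcons u y) x s'
  else 0.

Fixpoint sort_cost u s :=
  if s is x :: s' then sort_cost (rcons u x) s' + ins_cost u x (isort s') else 0.

Lemma ins_cost_far a x y b z s :
  ins_cost (a ++ x :: y :: b) z s - ins_cost (a ++ y :: x :: b) z s =
  delta a x y (b ++ z :: s) - delta a x y (b ++ ins z s).
Proof.
elim: s b => [|t s IH] b /=; first by rewrite !subrr.
case: ifP => zt; first by rewrite !subrr.
rewrite opprD addrACA -delta_far !rcons_cat /= IH !cat_rcons.
by rewrite addrA subrK.
Qed.

(** Exchanging two letters of the prefix commutes with sorting what follows. *)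
Lemma sort_cost_far a x y b s :
  sort_cost (a ++ x :: y :: b) s - sort_cost (a ++ y :: x :: b) s =
  delta a x y (b ++ s) - delta a x y (b ++ isort s).
Proof.
elim: s b => [|z s IH] b /=; first by rewrite !subrr.
by rewrite opprD addrACA ins_cost_far !rcons_cat /= IH !cat_rcons addrA subrK.
Qed.

(** The hexagon for two letters inserted one after the other into [s]; each step
    of the induction uses one instance of [delta_braid], and [ins_cost_far] to
    move the recursive calls to a common prefix. *)
Lemma ins_cost_braid u x y s :
  ins_cost (rcons u x) y s + ins_cost u x (ins y s)
  - ins_cost (rcons u y) x s - ins_cost u y (ins x s) = delta u x y s.
Proof.
wlog xy : x y / ~~ le x y.
  move=> H; case xy : (le x y); last by apply: H; rewrite xy.
  case yx : (le y x); last by rewrite delta_anti -H ?yx //; lin_split K; ring.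
  rewrite (@le_anti x y) ?xy // delta_diag; lin_split K; ring.
have yx := nle_le xy; elim: s u => [|z s IH] u /=.
  by rewrite (negbTE xy) yx !subr0 add0r addr0.
case yz : (le y z) => /=.
  rewrite (negbTE xy) /=.
  have -> : ins_cost u y (if le x z then x :: z :: s else z :: ins x s) = 0.
    by case: ifP => /=; rewrite ?yx ?yz.
  rewrite subr0 add0r; case: ifP => // xz; rewrite ?addr0 ?subr0 ?addrK //.
have zx := nle_trans xy (nle_le (negbT yz)); rewrite (negbTE zx) /= yz.
have E1 := ins_cost_far u x z [::] y s; have E2 := ins_cost_far u y z [::] x s.
move: (IH (rcons u z)) (delta_braid u x y z s) E1 E2 => /=.
rewrite -!cats1 -!catA /= => IHu B E1 E2.
apply: (lin_use 1 IHu); apply: (lin_use (-1) B); apply: (lin_use 1 E1).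
apply: (lin_use (-1) E2); lin_split K; ring.
Qed.

(** The cost of sorting is a potential for [delta]. Only the exchange of the two
    first letters is not immediate from the recursion: there the path of
    insertion sort is compared with the direct exchange by means of
    [sort_cost_far] and [ins_cost_braid]. *)
Lemma sort_cost_swap u s1 x y s2 :
  sort_cost u (s1 ++ x :: y :: s2) - sort_cost u (s1 ++ y :: x :: s2) =
  delta (u ++ s1) x y s2.
Proof.
elim: s1 u => [|z s1 IH] u /=; last first.
  by rewrite isort_swap opprD addrACA subrr addr0 IH cat_rcons.
have E := sort_cost_far u x y [::] s2; have B := ins_cost_braid u x y (isort s2).
move: E B; rewrite cats0 -!cats1 -!catA /= => E B.
by apply: (lin_use 1 E); apply: (lin_use 1 B); lin_split K; ring.
Qed.

End SwapPotential.

Section SortCostSorted.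
Variables (A : eqType) (le : rel A) (K : comNzRingType) (M : lmodType K).
Variable delta : seq A -> A -> A -> seq A -> M.
Lemma sort_cost_sorted u s : sorted le s -> sort_cost le delta u s = 0.
Proof.
elim: s u => // x s IH u xs.
have ss : sorted le s by case: s xs {IH} => //= y s /andP[].
rewrite /= IH // isort_id // add0r.
by case: s xs {IH ss} => //= y s /andP[-> _].
Qed.
End SortCostSorted.

(** * Sums over the integers with finite support *)

Section IntegerSums.
Variables (K : comNzRingType) (T : lmodType K).
Implicit Types (s t : int -> T).

(** The value is only meaningful for [s] of finite support; it is then a finite
    sum over a window around 0, from which the rules below follow. *)
Definition isum s : T := \sum_(k \in [set: int]%classic) s k.

Definition supported (B : nat) s := forall k : int, (B < `|k|)%N -> s k = 0.

Definition finsupp s := exists B, supported B s.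

Definition window (B : nat) s : T := \sum_(i < (B + B).+1) s (i%:Z - B%:Z).

Lemma isum_window B s : supported B s -> isum s = window B s.
Proof.
move=> sB; rewrite /isum (fsbigE [seq i%:Z - B%:Z | i <- iota 0 (B + B).+1]) //.
- rewrite big_map /window -(big_mkord xpredT (fun i : nat => s (i%:Z - B%:Z))).
  by rewrite /index_iota subn0; apply: congr_big => // i; rewrite in_setT.
- by rewrite map_inj_uniq ?iota_uniq // => i j; lia.
- move=> k _ kB; apply: sB; rewrite ltnNge; apply: contra kB => kB.
  by apply/mapP; exists (absz (k + B%:Z)); rewrite ?mem_iota; lia.
Qed.

Lemma eq_isum s t : s =1 t -> isum s = isum t.
Proof. by move=> /funext->. Qed.

Lemma supported_le B B' s : (B <= B')%N -> supported B s -> supported B' s.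
Proof. by move=> BB sB k kB; apply: sB; apply: leq_ltn_trans kB. Qed.

Lemma finsupp_common s t :
  finsupp s -> finsupp t -> exists B, supported B s /\ supported B t.
Proof.
move=> [B sB] [B' tB']; exists (maxn B B'); split.
  by apply: supported_le sB; rewrite leq_maxl.
by apply: supported_le tB'; rewrite leq_maxr.
Qed.

Lemma finsupp_bounds s (a b : int) :
  (forall k : int, k < a -> s k = 0) -> (forall k : int, b < k -> s k = 0) -> finsupp s.
Proof.
move=> sa sb; exists (`|a| + `|b|)%N => k kab.
by case: (ltP k a) => [/sa//|ak]; apply: sb; lia.
Qed.

Lemma finsuppD s t : finsupp s -> finsupp t -> finsupp (fun k => s k + t k).
Proof.
move=> fs /(finsupp_common fs)[B [sB tB]].
by exists B => k kB; rewrite sB // tB // addr0.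
Qed.

Lemma finsuppZ (a : int -> K) s : finsupp s -> finsupp (fun k => a k *: s k).
Proof. by case=> B sB; exists B => k kB; rewrite sB // scaler0. Qed.

Lemma finsuppN s : finsupp s -> finsupp (fun k => - s k).
Proof. by case=> B sB; exists B => k kB; rewrite sB // oppr0. Qed.

Lemma isumD s t : finsupp s -> finsupp t ->
  isum (fun k => s k + t k) = isum s + isum t.
Proof.
move=> fs /(finsupp_common fs)[B [sB tB]].
rewrite (isum_window sB) (isum_window tB) (@isum_window B) => [|k kB].
  by rewrite /window big_split.
by rewrite sB // tB // addr0.
Qed.

Lemma isumZ a s : finsupp s -> isum (fun k => a *: s k) = a *: isum s.
Proof.
move=> [B sB]; rewrite (isum_window sB) (@isum_window B) => [|k kB].
  by rewrite /window scaler_sumr.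
by rewrite sB // scaler0.
Qed.

Lemma isumN s : finsupp s -> isum (fun k => - s k) = - isum s.
Proof.
move=> fs; rewrite -scaleN1r -isumZ //; apply: eq_isum => k.
by rewrite scaleN1r.
Qed.

Lemma isumB s t : finsupp s -> finsupp t ->
  isum (fun k => s k - t k) = isum s - isum t.
Proof. by move=> fs ft; rewrite isumD ?isumN //; exact: finsuppN. Qed.

Lemma isum0 s : (forall k, s k = 0) -> isum s = 0.
Proof. by move=> s0; apply: fsbig1. Qed.

Lemma isum_shift x s : isum (fun k => s (k + x)) = isum s.
Proof.
rewrite /isum [RHS](reindex_fsbigT (fun k => k + x)) //.
by exists (fun k => k - x) => k; rewrite ?addrK ?subrK.
Qed.

Lemma isum_reflect N s : isum (fun k => s (N - k)) = isum s.
Proof.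
rewrite /isum [RHS](reindex_fsbigT (fun k => N - k)) //.
by exists (fun k => N - k) => k; rewrite subKr.
Qed.

Lemma isum_pred1 p t : isum (fun k => if k == p then t k else 0) = t p.
Proof.
rewrite /isum (fsbigE [:: p]) //=.
  by rewrite big_cons big_nil eqxx in_setT addr0.
by move=> k _; rewrite inE => /negbTE->.
Qed.

Lemma finsupp_pred1 p t : finsupp (fun k => if k == p then t k else 0).
Proof. by apply: (@finsupp_bounds _ p p) => k kp; case: eqP => // pk; lia. Qed.

End IntegerSums.

Lemma int_shift_invariant_const (T : Type) (f : int -> T) :
  (forall p : int, f (p + 1) = f p) -> forall p q : int, f p = f q.
Proof.
move=> f1; suff f0 p : f p = f 0 by move=> p q; rewrite !f0.
elim: p => [//|n IH|n IH]; first by rewrite -IH -(f1 n%:Z); congr f; lia.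
by rewrite -IH -(f1 (- n.+1%:Z)); congr f; lia.
Qed.

Section Threshold.
Variables (K : comNzRingType) (T : lmodType K) (P Q : int -> T).
Variables (a b : int).
Hypothesis Pb : forall k : int, b < k -> P k = 0.
Hypothesis Qa : forall k : int, k < a -> Q k = 0.

(** The shape of a normally ordered sum: [P] beyond the threshold, [Q] before. It
    has finite support although [P] and [Q] may both vanish on one side only. *)
Definition cut (p k : int) : T := if p <= k then P k else Q k.

Lemma finsupp_cut p : finsupp (cut p).
Proof.
apply: (@finsupp_bounds _ _ _ (Num.min a p) (Num.max b p)) => k; rewrite /cut.
  by rewrite lt_min => /andP[ka kp]; rewrite leNgt kp /= Qa.
by rewrite gt_max => /andP[bk pk]; rewrite ltW // Pb.
Qed.

(** Moving the threshold from [q] to [p] exchanges finitely many terms; their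
    differences telescope as soon as they are the increments of a function. *)
Lemma isum_cut_shift (F : int -> K) (H : int -> T) (p q : int) :
  (forall k : int, F k *: (Q k - P k) = H (k + 1) - H k) ->
  isum (fun k => F k *: cut p k) = isum (fun k => F k *: cut q k) + (H p - H q).
Proof.
move=> HF; suff E : isum (fun k => F k *: cut p k) - H p =
                    isum (fun k => F k *: cut q k) - H q.
  by apply: (lin_use 1 E); lin_split K; ring.
move: p q; apply: int_shift_invariant_const => p.
have -> : isum (fun k => F k *: cut (p + 1) k) =
  isum (fun k => F k *: cut p k +
                 (if k == p then F k *: (Q k - P k) else 0)).
  apply: eq_isum => k; rewrite /cut; case: eqP => [->|kp].
    rewrite lexx ifF; last by lia.
    by lin_split K; ring.
  by rewrite addr0; have -> : (p + 1 <= k) = (p <= k) by lia.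
rewrite isumD; first last.
- exact: finsupp_pred1.
- exact/finsuppZ/finsupp_cut.
by rewrite (isum_pred1 p (fun k => F k *: (Q k - P k))) HF; lin_split K; ring.
Qed.

End Threshold.

(** * Letters, words and the bracket of two letters *)

(** [Lx n] and [Wx n] stand for the operators [L_n] and [W_n]. *)
Definition letter : Type := (bool * int)%type.
Definition Lx (n : int) : letter := (false, n).
Definition Wx (n : int) : letter := (true, n).

Definition mode (x : letter) : int := x.2.
Arguments mode !x /.

HB.instance Definition _ := Equality.on letter.

(** With this weight all terms of the bracket of two letters are lighter than
    the product of the letters: the products [L_k L_l] in the bracket of two [W]
    have weight 2, which is less than 4. *)
Definition weight1 (x : letter) : nat := if x.1 then 2 else 1.
Definition weight (w : seq letter) : nat := \sum_(x <- w) weight1 x.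
Definition deg (w : seq letter) : int := \sum_(x <- w) mode x.

Lemma weight_nil : weight [::] = 0%N. Proof. exact: big_nil. Qed.
Lemma weight_cons x w : weight (x :: w) = (weight1 x + weight w)%N.
Proof. exact: big_cons. Qed.
Lemma weight_cat w w' : weight (w ++ w') = (weight w + weight w')%N.
Proof. exact: big_cat. Qed.
Lemma weight_rcons w x : weight (rcons w x) = (weight w + weight1 x)%N.
Proof. by rewrite -cats1 weight_cat weight_cons weight_nil addn0. Qed.
Definition weightE := (weight_rcons, weight_cat, weight_cons, weight_nil).
Lemma deg_nil : deg [::] = 0. Proof. exact: big_nil. Qed.
Lemma deg_cons x w : deg (x :: w) = mode x + deg w.
Proof. exact: big_cons. Qed.
Lemma deg_cat w w' : deg (w ++ w') = deg w + deg w'.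
Proof. exact: big_cat. Qed.
Lemma deg_rcons w x : deg (rcons w x) = deg w + mode x.
Proof. by rewrite -cats1 deg_cat deg_cons deg_nil addr0. Qed.
Definition degE := (deg_rcons, deg_cat, deg_cons, deg_nil).

Lemma weight1_gt0 x : (0 < weight1 x)%N. Proof. by rewrite /weight1; case: x.1. Qed.

Lemma weight_perm s t : perm_eq s t -> weight s = weight t.
Proof. exact: perm_big. Qed.

Lemma deg_perm s t : perm_eq s t -> deg s = deg t.
Proof. exact: perm_big. Qed.

Lemma weight_eq0 w : weight w = 0%N -> w = [::].
Proof. by case: w => // x w; rewrite weight_cons; have := weight1_gt0 x; lia. Qed.

Section LetterOrder.

(** The order of the PBW monomials: first the [L_n] and then the [W_n] with
    [n < 0], and at the end the letters that act on the lowest weight vector by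
    scalars. *)
Definition letter_class (x : letter) : nat := if mode x < 0 then nat_of_bool x.1 else 2.
Definition letter_key (x : letter) : nat *l (int *l bool) :=
  (letter_class x, (mode x, x.1)).
Definition letter_le : rel letter :=
  fun x y => (letter_key x <= letter_key y)%O.

Lemma letter_le_total : total letter_le.
Proof. by move=> x y; exact: le_total. Qed.

Lemma letter_le_trans : transitive letter_le.
Proof. by move=> y x z; exact: le_trans. Qed.

Lemma letter_le_anti : antisymmetric letter_le.
Proof.
move=> [a m] [b n] /le_anti E.
have [-> ->] : m = n /\ a = b by case: E => _ -> ->.
by [].
Qed.

Lemma letter_leE x y : letter_le x y =
  (letter_class x < letter_class y)%N
  || ((letter_class x == letter_class y)
      && ((mode x < mode y) || ((mode x == mode y) && (x.1 <= y.1)%O))).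
Proof.
rewrite /letter_le /letter_key !lexi_pair /= !leEnat.
by case: (ltngtP (letter_class x) (letter_class y)) => //= _; case: (ltgtP (mode x) (mode y)).
Qed.

Lemma letter_le_nonneg x y : 0 <= mode x -> letter_le x y -> 0 <= mode y.
Proof.
move=> x0; rewrite letter_leE /letter_class ltNge x0 /=.
by case: ltP => //; case: y.1.
Qed.

End LetterOrder.

Section Bracket.

Variables (K : numFieldType) (c beta h0 w0 : K).

(** The coefficients in the bracket of [x] and [y] of the identity, of [L_N], of
    [W_N] and of [Lambda_N], where [N] is the sum of the modes; [beta] stands for
    the square of the constant [b]. *)
Definition coef1 (x y : letter) : K :=
  let m := mode x in let n := mode y in
  match x.1, y.1 with
  | false, false => c / 12 * (m * (m ^+ 2 - 1))%:~R * (m + n == 0)%:R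
  | true, true =>
      c / (3 * (5`!)%:R) * ((m ^+ 2 - 4) * (m ^+ 2 - 1) * m)%:~R
        * (m + n == 0)%:R
  | _, _ => 0
  end.

Definition coefL (x y : letter) : K :=
  let m := mode x in let n := mode y in
  match x.1, y.1 with
  | false, false => (m - n)%:~R
  | true, true =>
      1 / 30 * ((m - n) * (2 * m ^+ 2 - m * n + 2 * n ^+ 2 - 8))%:~R
  | _, _ => 0
  end.

Definition coefW (x y : letter) : K :=
  let m := mode x in let n := mode y in
  match x.1, y.1 with
  | false, true => (2 * m - n)%:~R
  | true, false => - (2 * n - m)%:~R
  | _, _ => 0
  end.

Definition coefLambda (x y : letter) : K :=
  if x.1 && y.1 then beta * (mode x - mode y)%:~R else 0.

(** The scalar by which a letter of nonnegative mode acts on the lowest weight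
    vector; it is only used for such letters. *)
Definition chi (x : letter) : K :=
  if mode x == 0 then if x.1 then w0 else h0 else 0.

Section Values.
Variable T : lmodType K.
Implicit Types F G : seq letter -> T.

(** [F] assigns values to the words that occur in a bracket, usually
    [F t = f (u ++ t ++ v)] for a context [u], [v]. This is the summand of the
    normally ordered square of [L(z)]. *)
Definition LL_term F (N : int) : int -> T :=
  cut (fun k => F [:: Lx (N - k); Lx k]) (fun k => F [:: Lx k; Lx (N - k)]) (-1).

Definition Lambda_value F (N : int) : T :=
  isum (LL_term F N) - (3 / 10 * ((N + 2) * (N + 3))%:~R) *: F [:: Lx N].

Definition bracket F (x y : letter) : T :=
  coef1 x y *: F [::] + coefL x y *: F [:: Lx (mode x + mode y)]
  + coefW x y *: F [:: Wx (mode x + mode y)]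
  + coefLambda x y *: Lambda_value F (mode x + mode y).

Lemma coef1_eq0 x y : mode x + mode y != 0 -> coef1 x y = 0.
Proof. by rewrite /coef1 => /negbTE->; case: x.1; case: y.1; rewrite ?mulr0. Qed.

(** Brackets are homogeneous for the degree and lower the weight. *)
Lemma eq_bracket F G x y :
  (forall t, deg t = mode x + mode y -> (weight t < weight1 x + weight1 y)%N ->
     F t = G t) ->
  bracket F x y = bracket G x y.
Proof.
move=> FG; rewrite /bracket; congr (_ + _ + _ + _).
- have [xy|/coef1_eq0->] := eqVneq (mode x + mode y) 0; last by rewrite !scale0r.
  by rewrite FG // ?degE // !weightE /weight1; case: x.1; case: y.1.
- by rewrite FG // !(degE, weightE) ?addr0 // /weight1; case: x.1; case: y.1.
- rewrite /coefW; case x1: x.1; case y1: y.1; rewrite ?scale0r // FG //;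
  by rewrite !(degE, weightE) ?addr0 // /weight1 x1 y1.
- rewrite /coefLambda; case: ifP => [/andP[x1 y1]|_]; last by rewrite !scale0r.
  rewrite /Lambda_value; congr (_ *: (_ - _ *: _)).
    apply: eq_isum => k; rewrite /LL_term /cut.
    by case: ifP => _; rewrite FG // !(degE, weightE) /= ?(addr0, subrK, addrNK);
       rewrite ?[k + _]addrC ?subrK // /weight1 x1 y1.
  by rewrite FG // !(degE, weightE) ?addr0 // /weight1 x1 y1.
Qed.

Lemma bracket_eq0 F x y :
  (forall t, deg t = mode x + mode y -> (weight t < weight1 x + weight1 y)%N ->
     F t = 0) ->
  bracket F x y = 0.
Proof.
move=> F0; rewrite (@eq_bracket _ (fun=> 0)) // /bracket /Lambda_value.
rewrite isum0 ?scaler0 ?subrr ?scaler0 ?addr0 // => k.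
by rewrite /LL_term /cut if_same.
Qed.

Lemma coef1_anti x y : coef1 y x = - coef1 x y.
Proof.
case: (eqVneq (mode x + mode y) 0) => [xy|xy]; last first.
  by rewrite !coef1_eq0 ?oppr0 // addrC.
have yE : mode y = - mode x by lia.
rewrite /coef1 yE [- mode x + _]addrC subrr eqxx -[true%:R]/(1 : K).
by case: x.1; case: y.1; rewrite ?oppr0 //; field; rewrite ?pnatr_eq0.
Qed.

Lemma coefL_anti x y : coefL y x = - coefL x y.
Proof. by rewrite /coefL; case: x.1; case: y.1; rewrite ?oppr0 //; field. Qed.

Lemma coefW_anti x y : coefW y x = - coefW x y.
Proof. by rewrite /coefW; case: x.1; case: y.1; rewrite ?oppr0 ?opprK. Qed.

Lemma coefLambda_anti x y : coefLambda y x = - coefLambda x y.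
Proof. by rewrite /coefLambda; case: x.1; case: y.1 => /=; ring. Qed.

Lemma bracket_anti F x y : bracket F y x = - bracket F x y.
Proof.
rewrite /bracket [mode y + mode x]addrC coef1_anti coefL_anti coefW_anti coefLambda_anti.
by lin_split K; ring.
Qed.

Lemma bracket_diag F x : bracket F x x = 0.
Proof.
have Ex (a : K) : a = - a -> a = 0.
  move=> /eqP; rewrite -subr_eq0 opprK -mulr2n mulrn_eq0 /= => /eqP //.
rewrite /bracket (Ex _ (coef1_anti x x)) (Ex _ (coefL_anti x x)).
rewrite (Ex _ (coefW_anti x x)) (Ex _ (coefLambda_anti x x)).
by rewrite !scale0r !addr0.
Qed.

(** For bounded values [Lambda_value] is a finite sum, as the right factor of
    every [LL_term] tends to infinity in both directions. *)
Definition bounded (M : int) F := forall a b, M < b -> F [:: Lx a; Lx b] = 0.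

Lemma finsupp_LL_term M F N : bounded M F -> finsupp (LL_term F N).
Proof.
by move=> FM; apply: (@finsupp_cut _ _ _ _ (N - M) M) => k Mk; apply: FM; lia.
Qed.

(** The same finite combination serves all values with the same bound; this gives
    linearity of brackets, and Fubini for two of them, from finite sums. *)
Lemma bracket_finite M x y : exists l : seq (K * seq letter),
  forall F, bounded M F -> bracket F x y = \sum_(p <- l) p.1 *: F p.2.
Proof.
have [B MB] : exists B, (`|M| + `|mode x| + `|mode y| < B)%N by eexists; exact: ltnSn.
have [n nB] : exists n, n = (B + B).+1 by exists (B + B).+1.
pose N := mode x + mode y.
pose lL := [seq (coefLambda x y, let k := i%:Z - B%:Z in
    if -1 <= k then [:: Lx (N - k); Lx k] else [:: Lx k; Lx (N - k)])
  | i : nat <- iota 0 n].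
exists ([:: (coef1 x y, [::]); (coefL x y, [:: Lx N]); (coefW x y, [:: Wx N]);
  (- (coefLambda x y * (3 / 10 * ((N + 2) * (N + 3))%:~R)), [:: Lx N])] ++ lL).
move=> F FM; rewrite big_cat !big_cons big_nil big_map /=.
rewrite /bracket /Lambda_value (@isum_window _ _ B) => [|k Bk]; last first.
  by rewrite /LL_term /cut; case: ifP => kc; apply: FM; lia.
rewrite /window -(big_mkord xpredT (fun i : nat => LL_term F N (i%:Z - B%:Z))).
rewrite /index_iota subn0 -nB.
rewrite -scaler_sumr [X in _ = _ + _ *: X](eq_bigr (fun i : nat => LL_term F N (i%:Z - B%:Z))) => [|i _].
  by rewrite -/N; lin_split K; ring.
by rewrite /LL_term /cut; case: ifP.
Qed.

(** The relations are compatible with the action on the lowest weight vector: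
    in the only case not excluded by the degree both modes vanish, and then all
    coefficients do. *)
Lemma bracket_nonneg F x y : 0 <= mode x -> 0 <= mode y ->
  (forall t, 0 < deg t -> (weight t < weight1 x + weight1 y)%N -> F t = 0) ->
  bracket F x y = 0.
Proof.
move=> x0 y0 F0; case: (ltP 0 (mode x + mode y)) => [xy|xy].
  by apply: bracket_eq0 => t tE wt; apply: F0; rewrite ?tE.
have [xE yE] : mode x = 0 /\ mode y = 0 by lia.
rewrite /bracket /coef1 /coefL /coefW /coefLambda xE yE subrr mul0r !mulr0.
by case: x.1; case: y.1; rewrite ?(mulr0, mul0r, scale0r, oppr0, addr0).
Qed.

End Values.

Section Linear.
Variable T : lmodType K.
Implicit Types F G : seq letter -> T.

Lemma boundedB M F G : bounded M F -> bounded M G -> bounded M (fun t => F t - G t).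
Proof. by move=> FM GM a b ab; rewrite FM // GM // subrr. Qed.

Lemma boundedZ M a F : bounded M F -> bounded M (fun t => a *: F t).
Proof. by move=> FM p q pq; rewrite FM // scaler0. Qed.

Lemma bracketB M F G x y : bounded M F -> bounded M G ->
  bracket (fun t => F t - G t) x y = bracket F x y - bracket G x y.
Proof.
move=> FM GM; have [l lE] := bracket_finite T M x y.
rewrite !lE //; last exact: boundedB.
by rewrite -sumrB; apply: eq_bigr => p _; rewrite scalerBr.
Qed.

Lemma bracketZ M a F x y : bounded M F ->
  bracket (fun t => a *: F t) x y = a *: bracket F x y.
Proof.
move=> FM; have [l lE] := bracket_finite T M x y.
rewrite !lE //; last exact: boundedZ.
by rewrite scaler_sumr; apply: eq_bigr => p _; rewrite !scalerA mulrC.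
Qed.

Lemma bounded_le M M' F : M <= M' -> bounded M F -> bounded M' F.
Proof. by move=> MM' FM a b ab; apply: FM; apply: le_lt_trans ab. Qed.

Lemma bracket_linear M M' a F G x y : bounded M F -> bounded M' G ->
  bracket (fun t => a *: F t + G t) x y = a *: bracket F x y + bracket G x y.
Proof.
move=> FM GM'; pose M2 := Num.max M M'.
have FM2 : bounded M2 F by apply: bounded_le FM; rewrite le_max lexx.
have GM2 : bounded M2 G by apply: bounded_le GM'; rewrite le_max lexx orbT.
have [l lE] := bracket_finite T M2 x y; rewrite !lE //.
  rewrite scaler_sumr -big_split; apply: eq_bigr => p _ /=.
  by rewrite scalerDr !scalerA mulrC.
by move=> i j ij; rewrite FM2 // GM2 // scaler0 addr0.
Qed.

Lemma bracket_exchange M M' (G : seq letter -> seq letter -> T) x y z t :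
  (forall s, bounded M (G s)) -> (forall r, bounded M' (G^~ r)) ->
  bracket (fun s => bracket (G s) z t) x y =
  bracket (fun r => bracket (G^~ r) x y) z t.
Proof.
move=> GM GM'.
have [l lE] := bracket_finite T M z t; have [l' lE'] := bracket_finite T M' x y.
under [LHS]eq_bracket do rewrite lE //.
under [RHS]eq_bracket do rewrite lE' //.
rewrite lE' => [|a b ab]; last first.
  by rewrite big1 // => p _; rewrite (GM' _ _ _ ab) scaler0.
rewrite lE => [|a b ab]; last first.
  by rewrite big1 // => p _; rewrite (GM _ _ _ ab) scaler0.
under eq_bigr do rewrite scaler_sumr.
under [RHS]eq_bigr do rewrite scaler_sumr.
rewrite exchange_big; apply: eq_bigr => p _; apply: eq_bigr => q _.
by rewrite !scalerA mulrC.
Qed.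

End Linear.
End Bracket.

(** * Functions on words satisfying the commutation relations *)

Section Solutions.

Variables (K : numFieldType) (c beta h0 w0 : K).
Local Notation bracket := (bracket c beta).
Local Notation chi := (chi h0 w0).

Definition all_neg (s : seq letter) := all (fun x => mode x < 0) s.

Section OneModule.
Variable T : lmodType K.
Implicit Types f g : seq letter -> T.

(** The relations are only required for words of weight at most [d], the range in
    which the inductive construction has already defined [f]. *)
Definition solution_upto d f :=
  (forall (u : seq letter) (x y : letter) (v : seq letter), (weight (u ++ x :: y :: v) <= d)%N ->
     f (u ++ x :: y :: v) - f (u ++ y :: x :: v) =
     bracket (fun t => f (u ++ t ++ v)) x y) /\
  (forall (u : seq letter) (x : letter), 0 <= mode x -> (weight (rcons u x) <= d)%N ->
     f (rcons u x) = chi x *: f u).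

Lemma sorted_rcons_letter s x : sorted letter_le (rcons s x) ->
  sorted letter_le s /\ forall y, y \in s -> letter_le y x.
Proof.
rewrite !(sorted_pairwise letter_le_trans) pairwise_rcons.
by case/andP=> /allP sx ss; split.
Qed.

(** A sorted word either consists of creation letters or ends with a letter of
    nonnegative degree. *)
Lemma sorted_last s x : sorted letter_le (rcons s x) -> mode x < 0 ->
  all_neg (rcons s x).
Proof.
move=> /sorted_rcons_letter[_ sx] x0; apply/allP => y; rewrite mem_rcons inE.
case/orP=> [/eqP->//|/sx yx]; rewrite ltNge; apply: contraL x0 => y0.
by rewrite -leNgt; apply: letter_le_nonneg yx.
Qed.

Lemma deg_all_neg s : all_neg s -> deg s <= 0 /\ (s != [::] -> deg s < 0).
Proof.
elim: s => [|x s IH] /=; first by rewrite deg_nil.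
by case/andP=> x0 /IH[s0 _]; rewrite deg_cons; split=> [|_]; lia.
Qed.

(** By induction on the weight it suffices to treat a sorted [t]: exchanging
    letters of [t] only adds lighter words with the same final degree. A sorted
    word of positive degree ends with a letter of nonnegative mode. *)
Lemma solution_deg_gt0 d f : solution_upto d f ->
  forall u t, (weight (u ++ t) <= d)%N -> 0 < deg t -> f (u ++ t) = 0.
Proof.
move=> [f_swap f_end] u t; have [n] := ubnP (weight t).
elim: n t => // n IH t tn ut t0.
have := perm_isort letter_le t; have st := isort_sorted letter_le_total t.
set s := isort letter_le t in st * => pst.
apply: (perm_adjacent (P := fun s => perm_eq s t -> f (u ++ s) = 0) _ pst) => //.
  move=> s1 x y s2 Ps pt.
  have pt' : perm_eq (s1 ++ x :: y :: s2) t.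
    exact: perm_trans (perm_adjacent_swap _ _ _ _) pt.
  have := weight_perm pt; have := deg_perm pt.
  rewrite !(degE, weightE) => dt wt.
  have := f_swap (u ++ s1) y x s2; rewrite -!catA Ps // subr0 => ->.
    apply: bracket_eq0 => r dr wr; rewrite -catA; apply: IH.
    - by rewrite !weightE; lia.
    - by move: ut; rewrite !weightE; lia.
    - by rewrite !degE; lia.
  by move: ut; rewrite !weightE; lia.
move=> {}pst; have dst := deg_perm pst; have wst := weight_perm pst.
move: st pst dst wst; case/lastP: s => [|s x] st _; first by rewrite deg_nil => d0; exfalso; lia.
case: (ltP (mode x) 0) => [/(sorted_last st)/deg_all_neg[d0 _] dst|x0].
  by exfalso; move: d0; rewrite dst; lia.
rewrite !(degE, weightE) => dst wst; have x1 := weight1_gt0 x.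
rewrite -rcons_cat f_end //; last by move: ut; rewrite !weightE; lia.
rewrite /chi; case: eqP => [x2|_]; last by rewrite scale0r.
by rewrite IH ?scaler0 //; move: ut; rewrite ?weightE; lia.
Qed.

(** Sorting a word only adds lighter words, and the last letter of a sorted word
    can be removed unless all its modes are negative. *)
Lemma solution_unique d f g : solution_upto d f -> solution_upto d g ->
  (forall s, sorted letter_le s -> all_neg s -> f s = g s) ->
  forall w, (weight w <= d)%N -> f w = g w.
Proof.
move=> [f_swap f_end] [g_swap g_end] fg w.
have [n] := ubnP (weight w); elim: n w => // n IH w wn wd.
have := perm_isort letter_le w; have st := isort_sorted letter_le_total w.
set s := isort letter_le w in st * => pst.
apply: (perm_adjacent (P := fun s => perm_eq s w -> f s = g s) _ pst) => //.
  move=> s1 x y s2 Ps pt.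
  have pt' : perm_eq (s1 ++ x :: y :: s2) w.
    exact: perm_trans (perm_adjacent_swap _ _ _ _) pt.
  have := weight_perm pt; rewrite !weightE => wt.
  have E h : solution_upto d h -> h (s1 ++ y :: x :: s2) =
      h (s1 ++ x :: y :: s2) + bracket (fun t => h (s1 ++ t ++ s2)) y x.
    case=> h_swap _; rewrite -h_swap ?weightE; last by lia.
    by lin_split K; ring.
  rewrite !E // Ps //; congr (_ + _); apply: eq_bracket => t _ wtt.
  by apply: IH; rewrite !weightE; lia.
move=> {}pst; have wst := weight_perm pst.
move: st pst wst; case/lastP: s => [|s x] st _ wst; first exact: fg.
case: (ltP (mode x) 0) => [/(sorted_last st)/(fg _ st) //|x0].
move: wst; rewrite !weightE => wst; have x1 := weight1_gt0 x.
rewrite f_end ?weightE ?g_end ?weightE ?wst // IH //; first by rewrite -ltnS; lia.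
by apply: leq_trans wd; rewrite -wst leq_addr.
Qed.

End OneModule.
End Solutions.

(** * The Jacobi identities *)

Section Jacobi.

Variables (K : numFieldType) (c beta : K) (T : lmodType K).
Local Notation bracket := (bracket c beta).
Local Notation coef1 := (coef1 c).
(** [e t] is the value of a partially constructed solution at [u ++ t ++ v] for a
    fixed context; the commutation relations are available below weight [q]. *)
Variables (e : seq letter -> T) (M : int) (q : nat).
Hypothesis beta_c : beta * (22 + 5 * c) = 16.
Hypothesis e_deg : forall a t, M < deg t -> e (a ++ t) = 0.
Hypothesis e_swap : forall (a : seq letter) (x y : letter) (b : seq letter),
  (weight (a ++ x :: y :: b) < q)%N ->
  e (a ++ x :: y :: b) - e (a ++ y :: x :: b) = bracket (fun t => e (a ++ t ++ b)) x y.

(** The value of the iterated bracket of [x], [y] and [z], the inner bracket being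
    that of [x] and [y]. *)
Definition iterated (x y z : letter) : T :=
  bracket (fun t => e (t ++ [:: z])) x y - bracket (fun t => e (z :: t)) x y.

Lemma bracketLL F (m n : int) : bracket F (Lx m) (Lx n) =
  coef1 (Lx m) (Lx n) *: F [::] + (m - n)%:~R *: F [:: Lx (m + n)] :> T.
Proof. by rewrite /bracket /coefW /coefLambda /= !scale0r !addr0. Qed.

Lemma bracketLW F (m n : int) : bracket F (Lx m) (Wx n) =
  (2 * m - n)%:~R *: F [:: Wx (m + n)] :> T.
Proof. by rewrite /bracket /coef1 /coefL /coefLambda /= !scale0r !add0r !addr0. Qed.

Lemma bracketWL F (m n : int) : bracket F (Wx m) (Lx n) =
  - (2 * n - m)%:~R *: F [:: Wx (m + n)] :> T.
Proof. by rewrite /bracket /coef1 /coefL /coefLambda /= !scale0r !add0r !addr0. Qed.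

Lemma bracketWW F (m n : int) : bracket F (Wx m) (Wx n) =
  coef1 (Wx m) (Wx n) *: F [::] + coefL K (Wx m) (Wx n) *: F [:: Lx (m + n)]
  + (beta * (m - n)%:~R) *: Lambda_value F (m + n) :> T.
Proof. by rewrite /bracket /coefW /coefLambda /= !scale0r !addr0. Qed.

Lemma e_LL (m n : int) : (2 < q)%N -> e [:: Lx m; Lx n] = e [:: Lx n; Lx m] +
  (coef1 (Lx m) (Lx n) *: e [::] + (m - n)%:~R *: e [:: Lx (m + n)]).
Proof.
move=> q2; have := @e_swap [::] (Lx m) (Lx n) [::]; rewrite bracketLL /= => <-.
  by lin_split K; ring.
by rewrite !weightE.
Qed.

Lemma e_LW (m n : int) : (3 < q)%N -> e [:: Lx m; Wx n] = e [:: Wx n; Lx m] +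
  (2 * m - n)%:~R *: e [:: Wx (m + n)].
Proof.
move=> q2; have := @e_swap [::] (Lx m) (Wx n) [::]; rewrite bracketLW /= => <-.
  by lin_split K; ring.
by rewrite !weightE.
Qed.

Lemma e_WW (m n : int) : (4 < q)%N -> e [:: Wx m; Wx n] = e [:: Wx n; Wx m] +
  bracket e (Wx m) (Wx n).
Proof.
move=> q2; have := @e_swap [::] (Wx m) (Wx n) [::] => /=.
under eq_bracket do rewrite cats0.
by move=> <-; [lin_split K; ring|rewrite !weightE].
Qed.

Lemma e_LLL (x a b : int) : (3 < q)%N -> e [:: Lx x; Lx a; Lx b] = e [:: Lx a; Lx b; Lx x] +
  (coef1 (Lx x) (Lx a) *: e [:: Lx b] + (x - a)%:~R *: e [:: Lx (x + a); Lx b] +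
   coef1 (Lx x) (Lx b) *: e [:: Lx a] + (x - b)%:~R *: e [:: Lx a; Lx (x + b)]).
Proof.
move=> q3; have := @e_swap [::] (Lx x) (Lx a) [:: Lx b].
have := @e_swap [:: Lx a] (Lx x) (Lx b) [::].
rewrite !bracketLL /= !weightE => /(_ q3) E1 /(_ q3) E2.
apply: (lin_use 1 E1); apply: (lin_use 1 E2); lin_split K; ring.
Qed.

Lemma e_WLL (l a b : int) : (4 < q)%N -> e [:: Wx l; Lx a; Lx b] = e [:: Lx a; Lx b; Wx l] -
  ((2 * a - l)%:~R *: e [:: Wx (l + a); Lx b] +
   (2 * b - l)%:~R *: e [:: Lx a; Wx (l + b)]).
Proof.
move=> q3; have := @e_swap [::] (Wx l) (Lx a) [:: Lx b].
have := @e_swap [:: Lx a] (Wx l) (Lx b) [::].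
rewrite !bracketWL /= !weightE => /(_ q3) E1 /(_ q3) E2.
apply: (lin_use 1 E1); apply: (lin_use 1 E2); lin_split K; ring.
Qed.

Lemma bounded_rcons z : bounded (M - mode z) (fun t => e (t ++ [:: z])).
Proof.
by move=> a b ab; apply: (@e_deg [:: Lx a] _); rewrite !degE /=; lia.
Qed.

Lemma bounded_cons z : bounded M (fun t => e (z :: t)).
Proof. by move=> a b ab; apply: (@e_deg [:: z; Lx a] _); rewrite !degE /=; lia. Qed.

Lemma bounded_e : bounded M e.
Proof. by move=> a b ab; apply: (@e_deg [:: Lx a] _); rewrite !degE /=; lia. Qed.

Lemma coef1LL m n : coef1 (Lx m) (Lx n) =
  c / 12 * (m * (m ^+ 2 - 1))%:~R * (m + n == 0)%:R.
Proof. by []. Qed.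

(** [sum1 k], ..., [sum4 k] are the sums of the powers [j ^ 1], ..., [j ^ 4] over
    [0 <= j < k]; as polynomials they also make sense for negative [k]. *)
Definition sum1 (k : int) : K := k%:~R * (k%:~R - 1) / 2.
Definition sum2 (k : int) : K := k%:~R * (k%:~R - 1) * (2 * k%:~R - 1) / 6.
Definition sum3 (k : int) : K := (k%:~R * (k%:~R - 1) / 2) ^+ 2.
Definition sum4 (k : int) : K :=
  k%:~R * (k%:~R - 1) * (2 * k%:~R - 1) * (3 * k%:~R ^+ 2 - 3 * k%:~R - 1) / 30.

(** Commuting [L_x] through the sum of the [L_(n-k) L_k] produces two families of
    terms [L_(N-k) L_k], one of which is normally ordered with respect to the
    threshold [x - 1] instead of [-1]. Moving this threshold back costs
    commutators; these and the central terms are the corrections. *)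
Lemma LL_sum_L (n x N : int) : (3 < q)%N -> n + x = N ->
  isum (LL_term (fun t => e (t ++ [:: Lx x])) n)
  - isum (LL_term (fun t => e (Lx x :: t)) n) =
  - ((3 * x - n)%:~R *: isum (LL_term e N)
     + (- 2 * (sum2 (x - 1) - sum2 (- 1))
        + (4 * x + N)%:~R * (sum1 (x - 1) - sum1 (- 1)) - (2 * x * N * x)%:~R
        + c / 6 * (x * (x ^+ 2 - 1))%:~R) *: e [:: Lx N]
     + (c / 12 * (N == 0)%:R
          * (- (sum4 (x - 1) - sum4 (- 1)) + (2 * x)%:~R * (sum3 (x - 1) - sum3 (- 1))
             + (sum2 (x - 1) - sum2 (- 1))
             - (2 * x)%:~R * (sum1 (x - 1) - sum1 (- 1)))) *: e [::]).
Proof.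
move=> q3 nxN.
pose P (k : int) := e [:: Lx (N - k); Lx k]; pose Q (k : int) := e [:: Lx k; Lx (N - k)].
have PM (k : int) : M < k -> P k = 0 by exact: bounded_e.
have QM (k : int) : k < N - M -> Q k = 0 by move=> kM; apply: bounded_e; lia.
have fcut p : finsupp (cut P Q p) by exact: (finsupp_cut PM QM).
pose C := c / 12 * (x * (x ^+ 2 - 1))%:~R.
have fL := finsupp_LL_term n (@bounded_rcons (Lx x)).
have fR := finsupp_LL_term n (@bounded_cons (Lx x)).
rewrite -(isumB fL fR).
have -> : isum (fun k => LL_term (fun t => e (t ++ [:: Lx x])) n k
    - LL_term (fun t => e (Lx x :: t)) n k) =
  isum (fun k => - (((x - n + k)%:~R *: cut P Q (-1) k
    + (2 * x - (k + x))%:~R *: cut P Q (x - 1) (k + x))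
    + ((if k == N then C *: e [:: Lx k] else 0)
       + (if k == - x then C *: e [:: Lx (n - k)] else 0)))).
  apply: eq_isum => k.
  have -> : (if k == N then C *: e [:: Lx k] else 0) =
            coef1 (Lx x) (Lx (n - k)) *: e [:: Lx k].
    rewrite coef1LL /C; have -> : (x + (n - k) == 0) = (k == N) by lia.
    by case: eqP => _; rewrite ?mulr1 ?mulr0 ?scale0r.
  have -> : (if k == - x then C *: e [:: Lx (n - k)] else 0) =
            coef1 (Lx x) (Lx k) *: e [:: Lx (n - k)].
    rewrite coef1LL /C; have -> : (x + k == 0) = (k == - x) by lia.
    by case: eqP => _; rewrite ?mulr1 ?mulr0 ?scale0r.
  rewrite /LL_term /cut /P /Q /=; have -> : (x - 1 <= k + x) = (-1 <= k) by lia.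
  have -> : N - (k + x) = n - k by lia.
  have -> : x - n + k = x - (n - k) by lia.
  have -> : 2 * x - (k + x) = x - k by lia.
  have E1 : N - k = x + (n - k) by lia.
  have E2 : k + x = x + k by lia.
  by rewrite E1 E2; case: ifP => _; rewrite (e_LLL x) //; lin_split K; ring.
have fF (F : int -> K) p : finsupp (fun k => F k *: cut P Q p k) by exact: finsuppZ.
have fS : finsupp (fun k : int => (2 * x - (k + x))%:~R *: cut P Q (x - 1) (k + x)).
  case: (fcut (x - 1)) => B HB; exists (B + `|x|)%N => k Bk.
  by rewrite HB ?scaler0 //; lia.
have f1 : finsupp (fun k => if k == N then C *: e [:: Lx k] else 0).
  exact: (finsupp_pred1 N (fun k => C *: e [:: Lx k])).
have f2 : finsupp (fun k => if k == - x then C *: e [:: Lx (n - k)] else 0).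
  exact: (finsupp_pred1 (- x) (fun k => C *: e [:: Lx (n - k)])).
rewrite isumN; last by apply: finsuppD; apply: finsuppD.
congr (- _); rewrite isumD; [|exact: finsuppD|exact: finsuppD].
rewrite [isum (fun k => _ *: cut _ _ _ _ + _)]isumD //.
rewrite [isum (fun k => (if _ then _ else _) + _)]isumD //.
rewrite (isum_pred1 N (fun k => C *: e [:: Lx k])).
rewrite (isum_pred1 (- x) (fun k => C *: e [:: Lx (n - k)])).
rewrite (isum_shift x (fun k => (2 * x - k)%:~R *: cut P Q (x - 1) k)).
pose h1 (k : int) : K := - 2 * sum2 k + (4 * x + N)%:~R * sum1 k - (2 * x * N * k)%:~R.
pose h2 (k : int) : K := - sum4 k + (2 * x)%:~R * sum3 k + sum2 k - (2 * x)%:~R * sum1 k.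
pose H (k : int) : T := h1 k *: e [:: Lx N] + (c / 12 * (N == 0)%:R * h2 k) *: e [::].
rewrite (isum_cut_shift PM QM (F := fun k => (2 * x - k)%:~R) (H := H) _ (-1)); last first.
  move=> k; rewrite /Q /P (e_LL k) ?(ltnW q3) // coef1LL.
  have -> : k + (N - k) = N by lia.
  rewrite /H /h1 /h2 /sum1 /sum2 /sum3 /sum4.
  by lin_split K; field.
have -> : isum (LL_term e N) = isum (cut P Q (-1)) by [].
have : isum (fun k => (x - n + k)%:~R *: cut P Q (-1) k) +
       isum (fun k => (2 * x - k)%:~R *: cut P Q (-1) k) =
       (3 * x - n)%:~R *: isum (cut P Q (-1)).
  rewrite -isumD // -isumZ //; apply: eq_isum => k.
  by lin_split K; ring.
move=> E; apply: (lin_use 1 E).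
have -> : n - - x = N by lia.
by rewrite /H /h1 /h2 /C; lin_split K; field.
Qed.


(** The derivative term in [Lambda] cancels the central correction, so that
    [Lambda] is quasi-primary of weight 4. The remaining correction is
    [(22 + 5 c) / 30 (x^3 - x) L_N]; multiplied by [beta] it no longer depends on
    [c]. *)
Lemma Lambda_L (n x N : int) : (3 < q)%N -> n + x = N ->
  beta *: (Lambda_value (fun t => e (t ++ [:: Lx x])) n
           - Lambda_value (fun t => e (Lx x :: t)) n) =
  - ((beta * (3 * x - n)%:~R) *: Lambda_value e N
     + (16 / 30 * (x * (x ^+ 2 - 1))%:~R) *: e [:: Lx N]).
Proof.
move=> q3 nxN; rewrite /Lambda_value /=.
have E1 := LL_sum_L q3 nxN; have E2 := e_LL n x (ltnW q3).
have -> : 16 / 30 = beta * (22 + 5 * c) / 30 by rewrite beta_c.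
apply: (lin_use beta E1).
apply: (lin_use (- beta * (3 / 10 * ((n + 2) * (n + 3))%:~R)) E2).
rewrite coef1LL -nxN /sum1 /sum2 /sum3 /sum4; case: (eqVneq (n + x) 0) => [nx0|_].
  have -> : n = - x by lia.
  by rewrite -[true%:R]/(1 : K); lin_split K; field.
by rewrite -[false%:R]/(0 : K); lin_split K; field.
Qed.

(** Here the family that has to be renormalized comes from the reflection
    [k -> n - k], so its threshold is [n + 2]. The two coefficient families agree
    after the reflection, whence the factor 2. *)
Lemma LL_sum_W (n l N : int) : (4 < q)%N -> n + l = N ->
  let S := cut (fun k => e [:: Wx (N - k); Lx k])
               (fun k => e [:: Lx k; Wx (N - k)]) (-1) in
  isum (LL_term (fun t => e (t ++ [:: Wx l])) n)
  - isum (LL_term (fun t => e (Wx l :: t)) n) =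
  (2 * (2 * n - l))%:~R *: isum S - 4 *: isum (fun k => k%:~R *: S k)
  + (- 6 * (sum2 (n + 2) - sum2 (- 1))
     + (3 * (2 * n - l) + 2 * N)%:~R * (sum1 (n + 2) - sum1 (- 1))
     - ((2 * n - l) * N * (n + 3))%:~R) *: e [:: Wx N].
Proof.
move=> q4 nlN S.
pose P (k : int) := e [:: Wx (N - k); Lx k]; pose Q (k : int) := e [:: Lx k; Wx (N - k)].
have PM (k : int) : M < k -> P k = 0.
  by move=> Mk; apply: (@e_deg [:: Wx (N - k)]); rewrite !degE /=; lia.
have QM (k : int) : k < N - M -> Q k = 0.
  by move=> Mk; apply: (@e_deg [:: Lx k]); rewrite !degE /=; lia.
have fcut p : finsupp (cut P Q p) by exact: (finsupp_cut PM QM).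
have fF (F : int -> K) p : finsupp (fun k => F k *: cut P Q p k) by exact: finsuppZ.
have fL := finsupp_LL_term n (@bounded_rcons (Wx l)).
have fR := finsupp_LL_term n (@bounded_cons (Wx l)).
rewrite -(isumB fL fR); pose a := 2 * n - l.
have -> : isum (fun k => LL_term (fun t => e (t ++ [:: Wx l])) n k
    - LL_term (fun t => e (Wx l :: t)) n k) =
  isum (fun k => (a - 2 * k)%:~R *: cut P Q (-1) k
    + (a - 2 * (n - k))%:~R *: cut P Q (n + 2) (n - k)).
  apply: eq_isum => k.
  rewrite /LL_term /cut /P /Q /=; have -> : (n + 2 <= n - k) = ~~ (-1 <= k) by lia.
  have -> : N - (n - k) = l + k by lia.
  have -> : N - k = l + (n - k) by lia.
  rewrite /a; case: ifP => _ /=.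
    by rewrite (e_WLL l) //; lin_split K; ring.
  by rewrite (e_WLL l) //; lin_split K; ring.
have fS : finsupp (fun k : int => (a - 2 * (n - k))%:~R *: cut P Q (n + 2) (n - k)).
  case: (fcut (n + 2)) => B HB; exists (B + `|n|)%N => k Bk.
  by rewrite HB ?scaler0 //; lia.
rewrite isumD // (isum_reflect n (fun k => (a - 2 * k)%:~R *: cut P Q (n + 2) k)).
pose H (k : int) : T := (- 6 * sum2 k + (3 * a + 2 * N)%:~R * sum1 k
  - (a * N * k)%:~R) *: e [:: Wx N].
rewrite (isum_cut_shift PM QM (F := fun k => (a - 2 * k)%:~R) (H := H) (n + 2) (-1)); last first.
  move=> k; rewrite /Q /P (e_LW k) ?(ltnW q4) //.
  have -> : k + (N - k) = N by lia.
  by rewrite /H /sum1 /sum2; lin_split K; field.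
have -> : isum (fun k => (a - 2 * k)%:~R *: cut P Q (-1) k) =
  a%:~R *: isum S - 2 *: isum (fun k => k%:~R *: S k).
  have fS1 : finsupp S by exact: fcut.
  have fS2 : finsupp (fun k : int => k%:~R *: S k) by exact: finsuppZ.
  rewrite -(isumZ _ fS1) -(isumZ _ fS2) -isumB; [|exact: finsuppZ|exact: finsuppZ].
  by apply: eq_isum => k; rewrite -/(S k); lin_split K; ring.
by rewrite /H /a; lin_split K; field.
Qed.

Lemma Lambda_W (n l N : int) : (4 < q)%N -> n + l = N ->
  let S := cut (fun k => e [:: Wx (N - k); Lx k])
               (fun k => e [:: Lx k; Wx (N - k)]) (-1) in
  Lambda_value (fun t => e (t ++ [:: Wx l])) n - Lambda_value (fun t => e (Wx l :: t)) n =
  (2 * (2 * n - l))%:~R *: isum S - 4 *: isum (fun k => k%:~R *: S k)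
  + (- 6 * (sum2 (n + 2) - sum2 (- 1))
     + (3 * (2 * n - l) + 2 * N)%:~R * (sum1 (n + 2) - sum1 (- 1))
     - ((2 * n - l) * N * (n + 3))%:~R
     - 3 / 10 * ((n + 2) * (n + 3) * (2 * n - l))%:~R) *: e [:: Wx N].
Proof.
move=> q4 nlN S; rewrite /Lambda_value /=.
have := LL_sum_W q4 nlN; rewrite -/S => E1; have := e_LW n l (ltnW q4); rewrite nlN => E2.
apply: (lin_use 1 E1); apply: (lin_use (- (3 / 10 * ((n + 2) * (n + 3))%:~R)) E2).
by lin_split K; field.
Qed.

Lemma jacobi_LLL (x y z : int) : (2 < q)%N ->
  iterated (Lx x) (Lx y) (Lx z) + iterated (Lx y) (Lx z) (Lx x)
  + iterated (Lx z) (Lx x) (Lx y) = 0.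
Proof.
move=> q2; rewrite /iterated !bracketLL /=.
rewrite (e_LL (x + y)) // (e_LL (y + z)) // (e_LL (z + x)) //.
pose N := x + y + z.
have -> : y + z + x = N by rewrite /N; lia.
have -> : z + x + y = N by rewrite /N; lia.
rewrite -/N !coef1LL.
have -> : (y + z + x == 0) = (N == 0) by rewrite /N; lia.
have -> : (z + x + y == 0) = (N == 0) by rewrite /N; lia.
rewrite -/N; case: (eqVneq N 0) => [N0|_]; last by rewrite -[false%:R]/(0 : K); lin_split K; field.
have -> : z = - (x + y) by rewrite /N in N0; lia.
by rewrite -[true%:R]/(1 : K); lin_split K; field.
Qed.

Lemma jacobi_LLW (x y z : int) : (3 < q)%N ->
  iterated (Lx x) (Lx y) (Wx z) + iterated (Lx y) (Wx z) (Lx x)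
  + iterated (Wx z) (Lx x) (Lx y) = 0.
Proof.
move=> q3; rewrite /iterated !(bracketLL, bracketLW, bracketWL) /=.
have q2 := ltnW q3; pose N := x + y + z.
have E1 := e_LW (x + y) z q3; have E2 := e_LW x (y + z) q3; have E3 := e_LW y (z + x) q3.
move: E1 E2 E3.
have -> : x + (y + z) = N by rewrite /N; lia.
have -> : y + (z + x) = N by rewrite /N; lia.
move=> E1 E2 E3; rewrite -/N.
apply: (lin_use (x - y)%:~R E1); apply: (lin_use (- (2 * y - z)%:~R) E2).
apply: (lin_use (2 * x - z)%:~R E3).
by lin_split K; field.
Qed.

Lemma coef1WW m n : coef1 (Wx m) (Wx n) =
  c / (3 * (5`!)%:R) * ((m ^+ 2 - 4) * (m ^+ 2 - 1) * m)%:~R * (m + n == 0)%:R.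
Proof. by []. Qed.

Lemma coefLWW m n : coefL K (Wx m) (Wx n) =
  1 / 30 * ((m - n) * (2 * m ^+ 2 - m * n + 2 * n ^+ 2 - 8))%:~R.
Proof. by []. Qed.

Lemma jacobi_LWW (x y z : int) : (4 < q)%N ->
  iterated (Lx x) (Wx y) (Wx z) + iterated (Wx y) (Wx z) (Lx x)
  + iterated (Wx z) (Lx x) (Wx y) = 0.
Proof.
move=> q4; rewrite /iterated !(bracketWW, bracketLW, bracketWL) /=.
have q3 := ltnW q4; have q2 := ltnW q3; pose N := x + y + z.
have E1 := e_WW (x + y) z q4; have E2 := e_WW (z + x) y q4.
have E3 := e_LL (y + z) x q2.
have N1 : y + z + x = N by rewrite /N; lia.
have N2 : z + x + y = N by rewrite /N; lia.
have E4 := Lambda_L q3 N1.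
move: E1 E2 E3; rewrite !bracketWW N1 N2 -/N => E1 E2 E3.
apply: (lin_use (2 * x - y)%:~R E1); apply: (lin_use (- (2 * x - z)%:~R) E2).
apply: (lin_use (coefL K (Wx y) (Wx z)) E3); apply: (lin_use (y - z)%:~R E4).
rewrite !(coef1WW, coef1LL, coefLWW) N1 N2 -/N (_ : 5`!%:R = 120 :> K) //.
case: (eqVneq N 0) => [N0|_]; last first.
  by rewrite -[false%:R]/(0 : K); lin_split K; rewrite /N; field.
rewrite -[true%:R]/(1 : K).
rewrite /N in N0 *; have -> : z = - (x + y) by lia.
by lin_split K; field.
Qed.

(** The three sums have the same terms [S k], with coefficients that depend on [k]
    in an affine way; both the constant and the linear part cancel in the cyclic
    sum. *)
Lemma jacobi_WWW (x y z : int) : (5 < q)%N ->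
  iterated (Wx x) (Wx y) (Wx z) + iterated (Wx y) (Wx z) (Wx x)
  + iterated (Wx z) (Wx x) (Wx y) = 0.
Proof.
move=> q5; rewrite /iterated !bracketWW /=.
have q4 := ltnW q5; have q3 := ltnW q4; pose N := x + y + z.
have E1 := e_LW (x + y) z q3; have E2 := e_LW (y + z) x q3; have E3 := e_LW (z + x) y q3.
have N0 : x + y + z = N by [].
have N1 : y + z + x = N by rewrite /N; lia.
have N2 : z + x + y = N by rewrite /N; lia.
have := Lambda_W q4 N2; have := Lambda_W q4 N1; have := Lambda_W q4 N0 => /=.
set S := cut _ _ _ => E4 E5 E6.
move: E1 E2 E3; rewrite N0 N1 N2 => E1 E2 E3.
apply: (lin_use (beta * (x - y)%:~R) E4); apply: (lin_use (beta * (y - z)%:~R) E5).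
apply: (lin_use (beta * (z - x)%:~R) E6).
apply: (lin_use (coefL K (Wx x) (Wx y)) E1); apply: (lin_use (coefL K (Wx y) (Wx z)) E2).
apply: (lin_use (coefL K (Wx z) (Wx x)) E3).
rewrite !coefLWW /sum1 /sum2 /N.
by lin_split K; field.
Qed.

(** The identity is invariant under cyclic permutations, so four cases suffice. *)
Lemma jacobi x y z : (weight1 x + weight1 y + weight1 z <= q)%N ->
  iterated x y z + iterated y z x + iterated z x y = 0.
Proof.
case: x y z => [[] x] [[] y] [[] z] /= q6.
- exact: jacobi_WWW.
- by rewrite addrC addrA jacobi_LWW.
- by rewrite -addrA addrC jacobi_LWW.
- by rewrite -addrA addrC jacobi_LLW.
- exact: jacobi_LWW.
- by rewrite addrC addrA jacobi_LLW.
- exact: jacobi_LLW.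
- exact: jacobi_LLL.
Qed.
End Jacobi.

(** * Existence of solutions with prescribed values on sorted words *)

Section Existence.

Variables (K : numFieldType) (c beta h0 w0 : K) (T : lmodType K).
Hypothesis beta_c : beta * (22 + 5 * c) = 16.
Local Notation bracket := (bracket c beta).
Local Notation chi := (chi h0 w0).
Local Notation solution_upto := (@solution_upto K c beta h0 w0 T).
Variable p : seq letter -> T.

(** The value at a sorted word: either prescribed by [p], or obtained by letting
    the last letter act on the lowest weight vector. *)
Definition end_value (g : seq letter -> T) (s : seq letter) : T :=
  if s is x :: s' then
    let z := last x s' in
    if 0 <= mode z then chi z *: g (belast x s') else p s
  else p s.

Lemma end_value_rcons g s z :
  end_value g (rcons s z) = if 0 <= mode z then chi z *: g s else p (rcons s z).
Proof. by case: s => //= x s; rewrite last_rcons belast_rcons. Qed.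

Section Step.
Variables (d : nat) (g : seq letter -> T).

(** The prescribed differences at weight [d.+1], computed from the solution [g] up
    to weight [d]. They are set to zero for other weights in order that the
    coherence conditions hold for all words. *)
Definition swap_value (u : seq letter) (x y : letter) (v : seq letter) : T :=
  if weight (u ++ x :: y :: v) == d.+1
  then bracket (fun t => g (u ++ t ++ v)) x y else 0.

Definition extend (w : seq letter) : T :=
  if (weight w <= d)%N then g w
  else if weight w == d.+1 then
    end_value g (isort letter_le w) + sort_cost letter_le swap_value [::] w
  else 0.

Hypothesis g_sol : solution_upto d g.
Hypothesis g_large : forall w, (d < weight w)%N -> g w = 0.
Hypothesis g_init : forall s, sorted letter_le s -> all_neg s -> (weight s <= d)%N ->
  g s = p s.

Lemma g_deg u t : 0 < deg t -> g (u ++ t) = 0.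
Proof.
move=> t0; case: (leqP (weight (u ++ t)) d) => [wd|/g_large//].
exact: solution_deg_gt0 g_sol _ _ wd t0.
Qed.

Lemma g_swap (u : seq letter) (x y : letter) (v : seq letter) :
  (weight (u ++ x :: y :: v) <= d)%N ->
  g (u ++ x :: y :: v) - g (u ++ y :: x :: v) = bracket (fun t => g (u ++ t ++ v)) x y.
Proof. exact: g_sol.1. Qed.

Lemma swap_value_anti u x y v : swap_value u x y v = - swap_value u y x v.
Proof.
rewrite /swap_value (weight_perm (perm_adjacent_swap u x y v)).
by case: ifP => _; rewrite ?oppr0 // bracket_anti.
Qed.

Lemma swap_value_diag u x v : swap_value u x x v = 0.
Proof. by rewrite /swap_value bracket_diag if_same. Qed.

(** Both sides are values of [g] with two brackets inserted in the same word, in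
    either order. *)
Lemma swap_value_far u x y v z t r :
  swap_value u x y (v ++ z :: t :: r) - swap_value u x y (v ++ t :: z :: r) =
  swap_value (u ++ x :: y :: v) z t r - swap_value (u ++ y :: x :: v) z t r.
Proof.
rewrite /swap_value !weightE.
have -> : (weight1 t + (weight1 z + weight r) = weight1 z + (weight1 t + weight r))%N by lia.
set a := (_ + _)%N; have -> : (weight u + (weight1 x + (weight1 y + weight v)) +
    (weight1 z + (weight1 t + weight r)))%N = a by rewrite /a; lia.
have -> : (weight u + (weight1 y + (weight1 x + weight v)) +
    (weight1 z + (weight1 t + weight r)))%N = a by rewrite /a; lia.
case: eqP => [ad|_]; last by rewrite !subrr.
(* Outside the degree of the bracket of [z] and [t] the values are set to zero,
   which makes the bound in [GM'] uniform in [q]. *)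
pose G s q := if deg q == mode z + mode t then g (u ++ s ++ v ++ q ++ r) else 0.
have GM s : bounded (- deg r) (G s).
  move=> i j ij; rewrite /G; case: ifP => // _.
  by have := @g_deg (u ++ s ++ v ++ [:: Lx i]) (Lx j :: r);
     rewrite -!catA /=; apply; rewrite degE /=; lia.
have GM' q : bounded (- (deg v + (mode z + mode t) + deg r)) (G^~ q).
  move=> i j ij; rewrite /G; case: eqP => // dq.
  have := @g_deg (u ++ [:: Lx i]) (Lx j :: v ++ q ++ r).
  by rewrite -!catA /=; apply; rewrite !degE /=; lia.
have E := bracket_exchange c beta x y z t GM GM'.
transitivity (bracket (fun s => bracket (G s) z t) x y).
  rewrite -(bracketB c beta (M := - (deg v + (mode z + mode t) + deg r))).
  - apply: eq_bracket => s _ ws.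
    have := @g_swap (u ++ s ++ v) z t r; rewrite -!catA => ->; last first.
      by move: ad; rewrite /a !weightE; lia.
    by apply: eq_bracket => q dq _; rewrite /G dq eqxx -!catA.
  - move=> i j ij; have := @g_deg (u ++ [:: Lx i]) (Lx j :: v ++ z :: t :: r).
    by rewrite -!catA /=; apply; rewrite !degE /=; lia.
  - move=> i j ij; have := @g_deg (u ++ [:: Lx i]) (Lx j :: v ++ t :: z :: r).
    by rewrite -!catA /=; apply; rewrite !degE /=; lia.
rewrite E -(bracketB c beta (M := - deg r)).
- apply: eq_bracket => q dq wq.
  have := @g_swap u x y (v ++ q ++ r); rewrite -!catA /= => ->; last first.
    by move: ad; rewrite /a !weightE; lia.
  by apply: eq_bracket => s _ _; rewrite /G dq eqxx.
- move=> i j ij; have := @g_deg ((u ++ x :: y :: v) ++ [:: Lx i]) (Lx j :: r).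
  by rewrite -!catA /=; apply; rewrite !degE /=; lia.
- move=> i j ij; have := @g_deg ((u ++ y :: x :: v) ++ [:: Lx i]) (Lx j :: r).
  by rewrite -!catA /=; apply; rewrite !degE /=; lia.
Qed.

(** This is the Jacobi identity for [x], [y], [z] in the context [u], [v]. *)
Lemma swap_value_braid u x y z v :
  swap_value u x y (z :: v) + swap_value (rcons u y) x z v + swap_value u y z (x :: v) =
  swap_value (rcons u x) y z v + swap_value u x z (y :: v) + swap_value (rcons u z) x y v.
Proof.
rewrite /swap_value !weightE.
pose a := (weight u + (weight1 x + weight1 y + weight1 z) + weight v)%N.
set a1 := (weight u + _)%N; have -> : a1 = a by rewrite /a /a1; lia.
set a2 := (weight u + _ + _)%N; have -> : a2 = a by rewrite /a /a2; lia.
set a3 := (weight u + _)%N; have -> : a3 = a by rewrite /a /a3; lia.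
set a4 := (weight u + _ + _)%N; have -> : a4 = a by rewrite /a /a4; lia.
set a5 := (weight u + _)%N; have -> : a5 = a by rewrite /a /a5; lia.
set a6 := (weight u + _ + _)%N; have -> : a6 = a by rewrite /a /a6; lia.
case: eqP => [ad|_]; last by rewrite !addr0.
pose e t := g (u ++ t ++ v).
have e_deg a' t : - deg v < deg t -> e (a' ++ t) = 0.
  move=> t0; rewrite /e; have := @g_deg (u ++ a') (t ++ v).
  by rewrite -!catA; apply; rewrite !degE; lia.
have e_swap (a' : seq letter) (x' y' : letter) (b : seq letter) :
    (weight (a' ++ x' :: y' :: b) < weight1 x + weight1 y + weight1 z)%N ->
    e (a' ++ x' :: y' :: b) - e (a' ++ y' :: x' :: b) =
    bracket (fun t => e (a' ++ t ++ b)) x' y'.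
  move=> wt; have := @g_swap (u ++ a') x' y' (b ++ v).
  rewrite /e -!catA /= => ->; last by move: wt; rewrite /a in ad; rewrite !weightE; lia.
  by apply: eq_bracket => t _ _; rewrite -!catA.
have := jacobi beta_c e_deg e_swap (leqnn _).
have E1 i j k : bracket (fun t => e (t ++ [:: k])) i j = bracket (fun t => g (u ++ t ++ k :: v)) i j.
  by apply: eq_bracket => t _ _; rewrite /e -!catA.
have E2 i j k : bracket (fun t => e (k :: t)) i j = bracket (fun t => g (rcons u k ++ t ++ v)) i j.
  by apply: eq_bracket => t _ _; rewrite /e cat_rcons.
rewrite /iterated !E1 !E2 => J.
apply: (lin_use 1 J).
rewrite (bracket_anti _ _ _ x z) (bracket_anti _ _ (fun t => g (rcons u y ++ _)) x z).
by lin_split K; ring.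
Qed.

Lemma extend_le w : (weight w <= d)%N -> extend w = g w.
Proof. by rewrite /extend => ->. Qed.

Lemma extend_swap (u : seq letter) (x y : letter) (v : seq letter) :
  (weight (u ++ x :: y :: v) <= d.+1)%N ->
  extend (u ++ x :: y :: v) - extend (u ++ y :: x :: v) =
  bracket (fun t => extend (u ++ t ++ v)) x y.
Proof.
move=> wd; transitivity (bracket (fun t => g (u ++ t ++ v)) x y); last first.
  apply: eq_bracket => t _ wt; rewrite extend_le //.
  by move: wd; rewrite !weightE; lia.
rewrite /extend (weight_perm (perm_adjacent_swap u y x v)).
case: leqP => [wd'|wd']; first exact: g_swap.
have wE : weight (u ++ x :: y :: v) = d.+1 by apply/eqP; rewrite eqn_leq wd.
rewrite wE eqxx (isort_swap letter_le_total letter_le_trans letter_le_anti).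
have := sort_cost_swap letter_le_total letter_le_trans letter_le_anti
  swap_value_anti swap_value_diag swap_value_far swap_value_braid [::] u x y v.
rewrite /= {3}/swap_value wE eqxx => <-.
by lin_split K; ring.
Qed.

Lemma extend_sorted s : sorted letter_le s -> weight s = d.+1 -> extend s = end_value g s.
Proof.
move=> ss wE; rewrite /extend wE ltnn eqxx isort_id // sort_cost_sorted //.
by rewrite addr0.
Qed.

(** If [x] is maximal in the word, it stays at the end while the rest is sorted,
    and the claim follows from the definition of the value at sorted words.
    Otherwise the maximal letter [m] also has nonnegative mode and can be moved
    next to [x]; then [x] and [m] are exchanged, with vanishing bracket. *)
Lemma extend_end (u : seq letter) (x : letter) : 0 <= mode x ->
  (weight (rcons u x) <= d.+1)%N -> extend (rcons u x) = chi x *: extend u.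
Proof.
move=> x0; rewrite leq_eqVlt => /orP[/eqP wE|]; last first.
  rewrite ltnS => wd; rewrite !extend_le //; first exact: g_sol.2.
  by apply: leq_trans wd; rewrite weightE leq_addr.
have x1 := weight1_gt0 x.
rewrite [extend u]extend_le; last by move: wE; rewrite weightE; lia.
(* Validity of the relation for a final letter [z] does not depend on the order
   of the letters before it. *)
have permP z r r' : 0 <= mode z -> perm_eq r r' -> weight (rcons r z) = d.+1 ->
    extend (rcons r z) = chi z *: g r -> extend (rcons r' z) = chi z *: g r'.
  move=> z0 rr' wr Er; move: (perm_refl r).
  pose P s := perm_eq r s -> extend (rcons s z) = chi z *: g s.
  suff : P r' by move=> /(_ rr').
  apply: (perm_adjacent (P := P) _ rr') => // s1 a b s2 Ps rs.
  have rs' : perm_eq r (s1 ++ a :: b :: s2).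
    exact: perm_trans rs (perm_adjacent_swap _ _ _ _).
  have z1 := weight1_gt0 z; have ws := weight_perm rs'.
  have := @extend_swap s1 a b (rcons s2 z).
  have := @g_swap s1 a b s2.
  rewrite -!rcons_cons -!rcons_cat Ps //.
  have {}wr : (weight (s1 ++ a :: b :: s2) + weight1 z)%N = d.+1.
    by rewrite -ws -weight_rcons.
  have wd : (weight (s1 ++ a :: b :: s2) <= d)%N by lia.
  move=> /(_ wd) E1; rewrite weight_rcons wr => /(_ (leqnn _)) E2.
  have E3 : bracket (fun t => extend (s1 ++ t ++ rcons s2 z)) a b =
            chi z *: bracket (fun t => g (s1 ++ t ++ s2)) a b.
    rewrite -(bracketZ c beta _ _ _ (M := - deg s2)); last first.
      move=> i j ij; have := @g_deg (s1 ++ [:: Lx i]) (Lx j :: s2).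
      by rewrite -!catA; apply; rewrite degE /=; lia.
    apply: eq_bracket => t _ wt; rewrite -!rcons_cat extend_le; last first.
      by move: wr; rewrite !weightE; lia.
    by apply: g_sol.2 => //; move: wr; rewrite !weightE; lia.
  apply: (lin_use (-1) E2); apply: (lin_use (chi z) E1); apply: (lin_use (-1) E3).
  by lin_split K; ring.
have maxP z r : 0 <= mode z -> weight (rcons r z) = d.+1 ->
    sorted letter_le (rcons (isort letter_le r) z) ->
    extend (rcons r z) = chi z *: g r.
  move=> z0 wr sr; have pr := perm_isort letter_le r.
  apply: (permP _ _ _ z0 pr).
    by rewrite weightE (weight_perm pr) -wr weightE.
  rewrite extend_sorted ?end_value_rcons ?z0 //.
  by rewrite weightE (weight_perm pr) -wr weightE.
have := perm_isort letter_le (rcons u x).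
have := isort_sorted letter_le_total (rcons u x).
case/lastP: (isort letter_le (rcons u x)) => [|s m] sm psm.
  by have := perm_size psm; rewrite size_rcons.
have [ss mmax] := sorted_rcons_letter sm.
have [xm|xm] := eqVneq x m.
  apply: maxP => //; rewrite xm.
  have ps : perm_eq u s.
    by move: psm; rewrite -xm -!cats1 perm_cat2r perm_sym.
  by rewrite (isort_perm letter_le_total letter_le_trans letter_le_anti ps) isort_id.
have mu : m \in u.
  have : m \in rcons u x by rewrite -(perm_mem psm) mem_rcons mem_head.
  by rewrite mem_rcons inE eq_sym (negbTE xm).
have m0 : 0 <= mode m.
  apply: letter_le_nonneg x0 (mmax x _).
  have : x \in rcons s m by rewrite (perm_mem psm) mem_rcons mem_head.
  by rewrite mem_rcons inE (negbTE xm).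
have pu : perm_eq (rcons (rem m u) m) u.
  by rewrite perm_rcons perm_sym perm_to_rem.
have m1 := weight1_gt0 m; have wu := weight_perm pu; move: wE wu; rewrite !weightE => wE wu.
apply: (permP _ _ _ x0 pu); first by rewrite !weightE; lia.
have rE a b : rem m u ++ [:: a; b] = rcons (rcons (rem m u) a) b.
  by rewrite -!cats1 -catA.
have := @extend_swap (rem m u) m x [::]; rewrite !rE => E.
have {}E : extend (rcons (rcons (rem m u) m) x) = extend (rcons (rcons (rem m u) x) m).
  apply/eqP; rewrite -subr_eq0 E ?weightE; last by lia.
  apply/eqP; apply: bracket_nonneg => // t t0 wt.
  by rewrite cats0 extend_le ?g_deg // weightE; lia.
rewrite E maxP //.
- by rewrite !g_sol.2 //= ?scalerA ?[chi m * _]mulrC // !weightE; lia.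
- by rewrite !weightE; lia.
have ps : perm_eq (rcons (rem m u) x) s.
  have : perm_eq (rcons (rcons (rem m u) x) m) (rcons s m).
    have Er := perm_adjacent_swap (rem m u) x m [::].
    rewrite perm_sym (permPl psm) perm_sym -!cats1 -catA (permPl Er).
    by rewrite -cat_rcons perm_cat2r.
  by rewrite -!cats1 perm_cat2r.
by rewrite (isort_perm letter_le_total letter_le_trans letter_le_anti ps) isort_id.
Qed.

End Step.

(** [approx d] is a solution up to weight [d] and zero beyond. *)
Fixpoint approx (d : nat) : seq letter -> T :=
  if d is d'.+1 then extend d' (approx d')
  else fun w => if w == [::] then p [::] else 0.

Lemma approx_spec d :
  [/\ solution_upto d (approx d),
      forall w, (d < weight w)%N -> approx d w = 0
    & forall s, sorted letter_le s -> all_neg s -> (weight s <= d)%N ->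
        approx d s = p s].
Proof.
elim: d => [|d [g_sol g_large g_init]].
  split=> [|w|s _ _].
  - split=> [u x y v|u x _]; rewrite !weightE => wz.
      by have := weight1_gt0 x; lia.
    by have := weight1_gt0 x; lia.
  - by rewrite /=; case: eqP => // ->; rewrite weight_nil.
  - by rewrite leqn0 => /eqP/weight_eq0->.
split=> [|w wd|s ss sn].
- split; first exact: extend_swap.
  exact: extend_end.
- by rewrite /= /extend leqNgt (ltnW wd) /= gtn_eqF.
rewrite leq_eqVlt ltnS => /orP[/eqP wE|wd]; last by rewrite /= extend_le ?g_init.
rewrite /= extend_sorted //; case/lastP: s sn wE ss => // s x sn _ _.
rewrite end_value_rcons leNgt; suff -> : mode x < 0 by [].
by move/allP: sn; apply; rewrite mem_rcons mem_head.
Qed.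

Definition solution (f : seq letter -> T) := forall d, solution_upto d f.

Theorem solution_exists : exists f, solution f /\
  forall s, sorted letter_le s -> all_neg s -> f s = p s.
Proof.
pose f w := approx (weight w) w.
have fE d w : (weight w <= d)%N -> f w = approx d w.
  elim: d => [|d IH]; first by rewrite leqn0 /f => /eqP->.
  rewrite leq_eqVlt ltnS => /orP[/eqP wE|wd]; first by rewrite /f wE.
  by rewrite IH //= extend_le.
exists f; split=> [d|s ss sn]; last by rewrite /f; have [_ _ ->] := approx_spec (weight s).
have [[a_swap a_end] _ _] := approx_spec d; split=> [u x y v wd|u x x0 wd].
  rewrite !(fE d) ?a_swap //; last by rewrite (weight_perm (perm_adjacent_swap u y x v)).
  apply: eq_bracket => t _ wt; rewrite (fE d) //.
  by move: wd; rewrite !weightE; lia.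
rewrite !(fE d) ?a_end //.
by apply: leq_trans wd; rewrite weightE leq_addr.
Qed.

End Existence.

(** * PBW indices as sorted words *)

Section PbwWords.

Definition pbw_word (i : pbw_index) : seq letter :=
  map Lx (val i).1 ++ map Wx (val i).2.

Lemma sorted_pbw_word i : sorted letter_le (pbw_word i).
Proof.
case: i => -[s t] /= st; rewrite /pbw_word /=.
case/andP: st => /andP[ss sn] /andP[ts tn].
rewrite (sorted_pairwise letter_le_trans) pairwise_cat !pairwise_map.
have sorted_letters b r : sorted <=%R r -> all (fun n : int => n < 0) r ->
    pairwise (relpre (pair b) letter_le) r.
  rewrite (sorted_pairwise le_trans) => rs rn.
  apply: (sub_in_pairwise (P := fun n : int => n < 0) _ rn rs) => m n m0 n0 mn.
  have /= m0' : m < 0 := m0; have /= n0' : n < 0 := n0.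
  rewrite /= letter_leE /letter_class /= m0' n0' eqxx lexx.
  by move: mn; rewrite le_eqVlt => /orP[->|->]; rewrite ?orbT.
rewrite !sorted_letters // !andbT; apply/allrelP => _ _ /mapP[m ms ->] /mapP[n nt ->].
by rewrite letter_leE /letter_class /= (allP sn _ ms) (allP tn _ nt).
Qed.

Lemma all_neg_pbw_word i : all_neg (pbw_word i).
Proof.
case: i => -[s t] /= st; case/andP: (st) => /andP[_ sn] /andP[_ tn].
by rewrite /all_neg /pbw_word /= all_cat !all_map; apply/andP; split.
Qed.

Lemma pbw_wordP s : sorted letter_le s -> all_neg s -> exists i, pbw_word i = s.
Proof.
move=> ss sn; pose s1 := [seq mode x | x <- s & ~~ x.1]; pose s2 := [seq mode x | x <- s & x.1].
have modes_ok b : neg_nondecreasing [seq mode x | x <- s & x.1 == b].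
  apply/andP; split; last first.
    rewrite all_map; apply/allP => x; rewrite mem_filter => /andP[_ /(allP sn)].
    by [].
  rewrite sorted_map.
  have := sorted_filter letter_le_trans (fun x : letter => x.1 == b) ss.
  apply: (sub_in_sorted (P := fun x : letter => (x.1 == b) && (mode x < 0))); last first.
    apply/allP => x; rewrite mem_filter => /andP[xb xs].
    by apply/andP; split; last exact: (allP sn).
  move=> x y /andP[/eqP xb x0] /andP[/eqP yb y0]; rewrite letter_leE /letter_class x0 y0 xb yb.
  by rewrite ltnn eqxx lexx andbT /= le_eqVlt orbC => /orP[->|->]; rewrite ?orbT.
have pf : neg_nondecreasing s1 && neg_nondecreasing s2.
  have -> : s1 = [seq mode x | x <- s & x.1 == false].
    by rewrite /s1; congr map; apply: eq_filter => x; case: x.1.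
  have -> : s2 = [seq mode x | x <- s & x.1 == true].
    by rewrite /s2; congr map; apply: eq_filter => x; case: x.1.
  by rewrite !modes_ok.
exists (exist _ (s1, s2) pf : pbw_index).
apply: (sorted_eq letter_le_trans letter_le_anti (sorted_pbw_word _) ss).
rewrite /pbw_word /= /s1 /s2 -!map_comp.
rewrite (_ : map _ [seq x <- s | ~~ x.1] = [seq x <- s | ~~ x.1]); last first.
  by rewrite -[RHS]map_id; apply/eq_in_map => -[b n]; rewrite mem_filter /=; case: b.
rewrite (_ : map _ [seq x <- s | x.1] = [seq x <- s | x.1]); last first.
  by rewrite -[RHS]map_id; apply/eq_in_map => -[b n]; rewrite mem_filter /=; case: b.
have -> : [seq x <- s | x.1] = [seq x <- s | predC (fun x : letter => ~~ x.1) x].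
  by apply: eq_filter => x /=; rewrite negbK.
by apply/permPl/perm_filterC.
Qed.

Lemma pbw_word_inj : injective pbw_word.
Proof.
move=> i j; case: i j => -[s t] /= p1 [[s' t'] /= p2]; rewrite /pbw_word /= => E.
apply: val_inj => /=.
have F b b' (r : seq int) :
    [seq mode x | x <- map (pair b') r & x.1 == b] = if b' == b then r else [::].
  elim: r => [|n r IH] /=; first by rewrite if_same.
  by move: IH; case: ifP => //= _ ->.
have L b (r : seq int) (r' : seq int) : [seq mode x | x <- map Lx r ++ map Wx r' & x.1 == b]
   = if b then r' else r.
  by rewrite filter_cat map_cat !F; case: b; rewrite ?cats0.
congr (_, _); first by rewrite -[LHS](L false s t) E L.
by rewrite -[LHS](L true s t) E L.
Qed.

End PbwWords.

(** * Semilinear maps and operations on solutions *)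

Section Semilinear.
Variables (K : numFieldType) (sigma : {rmorphism K -> K}) (T T' : lmodType K).
Variable phi : T -> T'.

(** Linear and conjugate linear maps are treated together: [sigma] will be the
    identity or the complex conjugation. *)
Definition semilinear := forall a u v, phi (a *: u + v) = sigma a *: phi u + phi v.

Hypothesis phiP : semilinear.

Lemma semilinear0 : phi 0 = 0.
Proof.
have := phiP 1 0 0; rewrite rmorph1 !scale1r addr0 => /eqP.
by rewrite -subr_eq0 opprD addrA subrr sub0r oppr_eq0 => /eqP.
Qed.

Lemma semilinearD u v : phi (u + v) = phi u + phi v.
Proof. by rewrite -[u in LHS]scale1r phiP rmorph1 scale1r. Qed.

Lemma semilinearZ a u : phi (a *: u) = sigma a *: phi u.
Proof. by rewrite -[_ *: u]addr0 phiP semilinear0 addr0. Qed.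

Lemma semilinearB u v : phi (u - v) = phi u - phi v.
Proof. by rewrite -scaleN1r semilinearD semilinearZ rmorphN1 scaleN1r. Qed.

Lemma semilinear_sum I (r : seq I) (F : I -> T) :
  phi (\sum_(i <- r) F i) = \sum_(i <- r) phi (F i).
Proof. exact: (big_morph _ semilinearD semilinear0). Qed.

Lemma semilinear_isum s : finsupp s -> phi (isum s) = isum (fun k => phi (s k)).
Proof.
case=> B sB; rewrite (isum_window sB) (@isum_window _ _ B) => [|k kB].
  by rewrite /window semilinear_sum.
by rewrite sB // semilinear0.
Qed.
End Semilinear.

Lemma semilinear_comp (K : numFieldType) (sigma tau : {rmorphism K -> K})
  (T T' T'' : lmodType K) (phi : T -> T') (psi : T' -> T'') :
  semilinear sigma phi -> semilinear tau psi -> semilinear (tau \o sigma) (psi \o phi).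
Proof. by move=> phiP psiP a u v /=; rewrite phiP psiP. Qed.

Lemma semilinear_linear (K : numFieldType) (T T' : lmodType K) (l : {linear T -> T'}) :
  semilinear idfun l.
Proof. by move=> a u v; rewrite linearP. Qed.

Section SolutionTheory.

Variables (K : numFieldType) (c beta h0 w0 : K).
Local Notation bracket := (bracket c beta).
Local Notation chi := (chi h0 w0).
Local Notation solution := (@solution K c beta h0 w0 _).

Section OneModule.
Variable T : lmodType K.
Implicit Types f g : seq letter -> T.

Lemma solution_swap f : solution f -> forall (u : seq letter) (x y : letter) (v : seq letter),
  f (u ++ x :: y :: v) - f (u ++ y :: x :: v) = bracket (fun t => f (u ++ t ++ v)) x y.
Proof. by move=> fs u x y v; apply: (fs _).1 (leqnn _). Qed.

Lemma solution_end f : solution f -> forall (u : seq letter) (x : letter),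
  0 <= mode x -> f (rcons u x) = chi x *: f u.
Proof. by move=> fs u x x0; apply: (fs _).2 (leqnn _). Qed.

Lemma solution_deg f : solution f -> forall u t, 0 < deg t -> f (u ++ t) = 0.
Proof. by move=> fs u t t0; apply: solution_deg_gt0 (fs _) _ _ (leqnn _) t0. Qed.

Lemma solutionI f :
  (forall (u : seq letter) (x y : letter) (v : seq letter),
    f (u ++ x :: y :: v) - f (u ++ y :: x :: v) = bracket (fun t => f (u ++ t ++ v)) x y) ->
  (forall (u : seq letter) (x : letter), 0 <= mode x -> f (rcons u x) = chi x *: f u) ->
  solution f.
Proof. by move=> f_swap f_end d; split=> [u x y v _|u x x0 _]; auto. Qed.

Lemma solution_prefix s f : solution f -> solution (fun w => f (s ++ w)).
Proof.
move=> fs; apply: solutionI => [u x y v|u x x0].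
  rewrite !catA solution_swap //; apply: eq_bracket => t _ _.
  by rewrite -!catA.
by rewrite -rcons_cat solution_end.
Qed.

Lemma eq_solution f g : solution f -> solution g ->
  (forall i, f (pbw_word i) = g (pbw_word i)) -> f =1 g.
Proof.
move=> fs gs fg w; apply: solution_unique (fs _) (gs _) _ _ (leqnn _).
by move=> s ss /(pbw_wordP ss)[i <-].
Qed.

Lemma solution_pbw (p : pbw_index -> T) :
  beta * (22 + 5 * c) = 16 -> exists f, solution f /\ forall i, f (pbw_word i) = p i.
Proof.
move=> bc; pose q w := if pselect (exists i, pbw_word i = w) is left E
  then p (projT1 (cid E)) else 0.
have [f [fs fq]] := solution_exists h0 w0 bc q; exists f; split=> // i.
rewrite fq ?sorted_pbw_word ?all_neg_pbw_word // /q; case: pselect => [E|[]].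
  by case: cid => j /= /pbw_word_inj->.
by exists i.
Qed.

(** The relations are homogeneous, as letters of positive mode act by zero on the
    lowest weight vector. *)
Lemma solution_homogeneous f (d : int) :
  solution f -> solution (fun w => if deg w == d then f w else 0).
Proof.
move=> fs; apply: solutionI => [u x y v|u x x0].
  rewrite (deg_perm (perm_adjacent_swap u y x v)); case: eqP => [ud|ud].
    rewrite solution_swap //; apply: eq_bracket => t td _.
    by rewrite ifT //; apply/eqP; rewrite -ud !degE td; lia.
  rewrite subrr bracket_eq0 // => t td _; rewrite ifF //.
  by apply/eqP => tv; apply: ud; rewrite -tv !degE td; lia.
rewrite solution_end // /chi degE; case: (eqVneq (mode x) 0) => [->|_].
  by rewrite addr0; case: ifP; rewrite ?scaler0.
by rewrite !scale0r if_same.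
Qed.

End OneModule.

Section Map.
Variables (T T' : lmodType K) (sigma : {rmorphism K -> K}) (phi : T -> T').
Hypothesis phiP : semilinear sigma phi.
Hypotheses (sc : sigma c = c) (sbeta : sigma beta = beta)
  (sh : sigma h0 = h0) (sw : sigma w0 = w0).

Lemma bracket_map M F x y : bounded M F ->
  phi (bracket F x y) = bracket (phi \o F) x y.
Proof.
move=> FM; rewrite /bracket /Lambda_value.
rewrite !(semilinearB phiP, semilinearD phiP, semilinearZ phiP).
rewrite (semilinear_isum phiP); last exact: finsupp_LL_term FM.
have -> : (fun k => phi (LL_term F (mode x + mode y) k)) =
          LL_term (phi \o F) (mode x + mode y).
  by apply/funext => k; rewrite /LL_term /cut; case: ifP.
have sE n : sigma n%:~R = n%:~R by rewrite rmorph_int.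
congr (_ *: _ + _ *: _ + _ *: _ + _ *: (_ - _ *: _)).
- by rewrite /coef1; case: x.1; case: y.1;
     rewrite ?rmorph0 // !(rmorphM, fmorphV, rmorph_nat, sE, sc).
- by rewrite /coefL; case: x.1; case: y.1;
     rewrite ?rmorph0 ?sE // !(rmorphM, fmorphV, rmorph1, rmorph_nat, sE).
- by rewrite /coefW; case: x.1; case: y.1; rewrite ?rmorph0 ?rmorphN ?sE.
- by rewrite /coefLambda; case: ifP; rewrite ?rmorph0 // rmorphM sE sbeta.
- by rewrite !(rmorphM, fmorphV, rmorph_nat, sE).
Qed.

Lemma solution_map (f : seq letter -> T) : solution f -> solution (phi \o f).
Proof.
move=> fs; apply: solutionI => [u x y v|u x x0] /=.
  rewrite -(semilinearB phiP) solution_swap // (bracket_map (M := - deg v)) //.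
  move=> a b ab; have := solution_deg fs (u ++ [:: Lx a]) (t := Lx b :: v).
  by rewrite -catA; apply; rewrite degE /=; lia.
rewrite solution_end // (semilinearZ phiP) /chi; congr (_ *: _).
by case: ifP; case: x.1; rewrite ?rmorph0.
Qed.

End Map.
End SolutionTheory.

(** * Bases and free modules *)

Section Bases.
Variables (R : realType) (V : lmodType R[i]) (I : eqType) (e : I -> V).
Hypothesis e_basis : is_basis e.

Lemma sum_count (T : nmodType) (f : I -> T) (s t : seq I) :
  uniq t -> {subset s <= t} ->
  \sum_(i <- s) f i = \sum_(j <- t) f j *+ count_mem j s.
Proof.
move=> tu; elim: s => [|i s IH] st.
  by rewrite big_nil big1 // => j _.
rewrite big_cons IH => [|j js]; last by apply: st; rewrite inE js orbT.
have -> : f i = \sum_(j <- t) f j *+ (i == j).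
  rewrite (bigD1_seq i) ?st ?mem_head //= eqxx mulr1n big1 ?addr0 // => j.
  by rewrite eq_sym => /negbTE->.
by rewrite -big_split; apply: eq_bigr => j _ /=; rewrite mulrnDr.
Qed.

Lemma basis_ind (P : V -> Prop) :
  P 0 -> (forall a u v, P u -> P v -> P (a *: u + v)) -> (forall i, P (e i)) ->
  forall v, P v.
Proof.
move=> P0 PD Pe v; have [s [a ->]] := e_basis.2 v.
by elim: s => [|i s IH]; rewrite ?big_nil // big_cons; apply: PD.
Qed.

Lemma eq_semilinear (V' : lmodType R[i]) (sigma : {rmorphism R[i] -> R[i]})
    (phi psi : V -> V') :
  semilinear sigma phi -> semilinear sigma psi ->
  (forall i, phi (e i) = psi (e i)) -> phi =1 psi.
Proof.
move=> phiP psiP E; apply: basis_ind => [|a u v Eu Ev|//].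
  by rewrite (semilinear0 phiP) (semilinear0 psiP).
by rewrite phiP psiP Eu Ev.
Qed.

(** The expansions given by [is_basis] may repeat indices; grouping them over a
    common list without repetitions makes the coefficients comparable. *)
Lemma basis_lift (V' : lmodType R[i]) (sigma : {rmorphism R[i] -> R[i]}) (b : I -> V') :
  exists phi : V -> V', semilinear sigma phi /\ forall i, phi (e i) = b i.
Proof.
have [r /(_ _)/cid r_spec] := choice (fun v => e_basis.2 v).
pose cf v := projT1 (r_spec v); pose al v j := cf v j *+ count_mem j (r v).
have alE v t : uniq t -> {subset r v <= t} -> v = \sum_(j <- t) al v j *: e j.
  move=> tu rt; rewrite [LHS](projT2 (r_spec v)) (sum_count _ tu rt).
  by apply: eq_bigr => j _; rewrite /al scalerMnl.
pose phi v := \sum_(j <- r v) sigma (cf v j) *: b j.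
have phiE v t : uniq t -> {subset r v <= t} ->
    phi v = \sum_(j <- t) sigma (al v j) *: b j.
  move=> tu rt; rewrite /phi (sum_count _ tu rt).
  by apply: eq_bigr => j _; rewrite /al rmorphMn scalerMnl.
exists phi; split=> [k u v|i].
  pose t := undup (r u ++ r v ++ r (k *: u + v)); have tu : uniq t := undup_uniq _.
  have ru : {subset r u <= t} by move=> j ju; rewrite mem_undup !mem_cat ju.
  have rv : {subset r v <= t} by move=> j jv; rewrite mem_undup !mem_cat jv orbT.
  have rw : {subset r (k *: u + v) <= t}.
    by move=> j jv; rewrite mem_undup !mem_cat jv !orbT.
  rewrite (phiE _ _ tu ru) (phiE _ _ tu rv) (phiE _ _ tu rw).
  rewrite scaler_sumr -big_split /=; apply: eq_big_seq => j jt.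
  rewrite scalerA -scalerDl -rmorphM -rmorphD; congr (sigma _ *: _).
  apply/eqP; rewrite -subr_eq0; apply/eqP.
  apply: (e_basis.1 t (fun j => al (k *: u + v) j - (k * al u j + al v j))) => //.
  under eq_bigr do rewrite scalerBl scalerDl -scalerA.
  rewrite sumrB big_split /= -scaler_sumr -!alE // subrr //.
pose t := undup (i :: r (e i)); have tu : uniq t := undup_uniq _.
have rt : {subset r (e i) <= t} by move=> j jt; rewrite mem_undup inE jt orbT.
have it : i \in t by rewrite mem_undup mem_head.
have al1 j : j \in t -> al (e i) j = (i == j)%:R.
  move=> jt; apply/eqP; rewrite -subr_eq0; apply/eqP.
  apply: (e_basis.1 t (fun j => al (e i) j - (i == j)%:R)) => //.
  under eq_bigr do rewrite scalerBl.
  rewrite sumrB -alE // (bigD1_seq i) //= eqxx scale1r big1 ?addr0 ?subrr // => l.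
  by rewrite eq_sym => /negbTE->; rewrite scale0r.
rewrite (phiE _ _ tu rt) (bigD1_seq i) //= al1 // eqxx rmorph1 scale1r.
rewrite big_seq_cond big1 ?addr0 // => j /andP[jt ji].
by rewrite al1 // eq_sym (negbTE ji) rmorph0 scale0r.
Qed.

End Bases.

Section FreeModule.
Import monalg.
Lemma free_module (R : realType) (I : choiceType) :
  exists (V : lmodType R[i]) (e : I -> V), is_basis e.
Proof.
exists (malg I R[i] : lmodType R[i]), (fun i => mkmalgU i 1).
have mcoefE (s : seq I) (a : I -> R[i]) j : mcoeff j (\sum_(i <- s) a i *: mkmalgU i 1) =
    \sum_(i <- s) a i * (i == j)%:R.
  by rewrite raddf_sum; apply: eq_bigr => i _; rewrite /= mcoeffZ mcoeffU.
split=> [s a su E j js|v].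
  have := mcoefE s a j; rewrite E mcoeff0 (bigD1_seq j) //= eqxx mulr1 big1 ?addr0 //.
  by move=> i /negbTE->; rewrite mulr0.
exists (finmap.enum_fset (msupp v)), (fun i => mcoeff i v).
rewrite {1}[v]monalgE; apply: eq_bigr => i _.
by apply/malgP => j; rewrite mcoeffZ !mcoeffU mulr_natr.
Qed.
End FreeModule.

(** * Representations as actions of words *)

Section Representations.
Variables (R : realType) (c : R[i]) (V : lmodType R[i]) (L W : int -> {linear V -> V}).

Definition act (x : letter) : {linear V -> V} := if x.1 then W (mode x) else L (mode x).

Definition word_act (t : seq letter) (v : V) : V := foldr (fun x => act x) v t.

(** The field condition for [L(z)], without the shift of the index. *)
Definition L_truncated := forall v, exists M : int, forall n, M < n -> L n v = 0.

Lemma word_act_cat s t v : word_act (s ++ t) v = word_act s (word_act t v).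
Proof. exact: foldr_cat. Qed.

Lemma word_act_semilinear t : semilinear idfun (word_act t).
Proof.
move=> a u v; elim: t => //= x t; rewrite /word_act /= => ->.
by rewrite linearP.
Qed.

Lemma is_field_shift (A : int -> {linear V -> V}) (d : int) :
  is_field (fun m => A (m - d)) <->
  forall v, exists M : int, forall n, M < n -> A n v = 0.
Proof.
split=> AF v; have [M HM] := AF v.
  by exists (M - d) => n Mn; rewrite -[n](addrK d) HM //; lia.
by exists (M + d + 1) => n Mn; apply: HM; lia.
Qed.

Lemma bounded_word_act (LN : L_truncated) v :
  exists M, bounded M (fun t => word_act t v).
Proof.
by have [M HM] := LN v; exists M => a b Mb; rewrite /word_act /= HM // linear0.
Qed.

Lemma Lambda_isum (LN : L_truncated) n v :
  Lambda L n v = Lambda_value (fun t => word_act t v) n.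
Proof.
have [M HM] := LN v.
rewrite /Lambda /Lambda_value; congr (_ - _).
rewrite (fsbig_mkcond _ [set k | - 2 < k]%classic) (fsbig_mkcond _ [set k | k <= - 2]%classic).
rewrite -/(isum _) -/(isum _) -isumD.
- apply: eq_isum => k; rewrite /patch /LL_term /cut /word_act /=.
  case: (ltP (-2) k) => k2.
    rewrite mem_set // memNset /=; last by apply/negP; rewrite -ltNge.
    by rewrite addr0 ifT //; lia.
  rewrite memNset /=; last by apply/negP; rewrite -leNgt.
  by rewrite mem_set // add0r ifF //; lia.
- apply: (@finsupp_bounds _ _ _ (- 2) M) => k kM; rewrite /patch.
    by rewrite memNset //=; apply/negP; rewrite -leNgt ltW.
  by rewrite HM // linear0 if_same.
apply: (@finsupp_bounds _ _ _ (n - M) (- 2)) => k kM; rewrite /patch.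
  by rewrite HM ?linear0 ?if_same //; lia.
by rewrite memNset //=; apply/negP; rewrite -ltNge.
Qed.

(** The three families of commutation relations in a single form. *)
Lemma rep_bracket : W3_representation c L W -> forall (x y : letter) v,
  act x (act y v) - act y (act x v) = bracket c (b2 c) (fun t => word_act t v) x y.
Proof.
case=> /is_field_shift LN _ LL LW WW [[] m] [[] n] v; rewrite /act /=.
- by rewrite bracketWW WW Lambda_isum // /word_act /= addrAC.
- by rewrite bracketWL -opprB LW scaleNr [n + m]addrC.
- by rewrite bracketLW LW.
- by rewrite bracketLL LL addrC.
Qed.

Lemma bracket_rep : L_truncated -> is_field (fun m => W (m - 3)) ->
  (forall (x y : letter) v,
    act x (act y v) - act y (act x v) = bracket c (b2 c) (fun t => word_act t v) x y) ->
  W3_representation c L W.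
Proof.
move=> LN WF B; split=> // [|m n v|m n v|m n v].
- exact/is_field_shift.
- by have := B (Lx m) (Lx n) v; rewrite bracketLL /act /= => ->; rewrite addrC.
- by have := B (Lx m) (Wx n) v; rewrite bracketLW.
have := B (Wx m) (Wx n) v; rewrite bracketWW /act /= => ->.
by rewrite Lambda_isum // addrAC.
Qed.

Variables (h w : R[i]) (Psi : V).

Lemma word_act_solution : W3_representation c L W ->
  lowest_weight_vector L W h w Psi ->
  solution c (b2 c) h w (fun t => word_act t Psi).
Proof.
move=> rep lwv; have LN : L_truncated by case: rep => /is_field_shift.
apply: solutionI => [u x y v|u x x0].
  rewrite !word_act_cat -(semilinearB (word_act_semilinear u)) /=.
  rewrite rep_bracket //.
  have [M HM] := bounded_word_act LN (word_act v Psi).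
  rewrite (bracket_map (word_act_semilinear u) (erefl c) (erefl (b2 c)) _ _ HM).
  by apply: eq_bracket => t _ _; rewrite /= !word_act_cat.
rewrite -cats1 word_act_cat -(semilinearZ (word_act_semilinear u)); congr word_act.
rewrite /= /act /chi; case: lwv => _ Lp Wp L0 W0.
case: x x0 => [[] m] /= m0; rewrite /word_act /act /=; case: eqP => [->|/eqP mn0] //.
  by rewrite Wp ?scale0r // lt_def mn0.
by rewrite Lp ?scale0r // lt_def mn0.
Qed.

Lemma pbw_vectorE i : pbw_vector L W Psi i = word_act (pbw_word i) Psi.
Proof. by rewrite /pbw_vector /pbw_word word_act_cat /word_act !foldr_map. Qed.

End Representations.

(** * Existence of Verma representations *)

Lemma linear_of_semilinear (K : numFieldType) (V V' : lmodType K) (phi : V -> V') :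
  semilinear idfun phi -> exists l : {linear V -> V'}, l =1 phi.
Proof.
move=> phiP.
pose l : {linear V -> V'} := HB.pack phi (GRing.isLinear.Build K V V' *:%R phi phiP).
by exists l.
Qed.

Section VermaModules.
Variables (R : realType) (c h w : R[i]).

Lemma b2_mul : c <> - (22 / 5) -> b2 c * (22 + 5 * c) = 16.
Proof.
move=> hc; rewrite /b2 divfK //; apply/eqP => c0; apply: hc.
have -> : c = ((22 + 5 * c) - 22) / 5 by field.
by rewrite c0 sub0r mulNr.
Qed.

Definition pbw_empty : pbw_index := exist _ ([::], [::]) (erefl true).

Lemma pbw_word_empty : pbw_word pbw_empty = [::].
Proof. by []. Qed.

(** [N] is the solution that sends PBW words to the corresponding basis vectors.
    The action of a letter is defined on these by prefixing; by uniqueness of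
    solutions it is then prefixing on [N t] for every word [t]. *)
Theorem Verma_exists : c <> - (22 / 5) ->
  exists (V : lmodType R[i]) (L W : int -> {linear V -> V}) (Psi : V),
    Verma_representation c h w L W Psi.
Proof.
move=> /b2_mul bc; have [V [e eb]] := free_module R pbw_index.
have [N [Ns Ne]] := solution_pbw h w e bc.
have Nind (P : V -> Prop) : P 0 -> (forall a u v, P u -> P v -> P (a *: u + v)) ->
    (forall t, P (N t)) -> forall v, P v.
  by move=> P0 PD PN; apply: (basis_ind eb) => // i; rewrite -Ne.
have /choice[A AE] : forall x : letter, exists l : {linear V -> V},
    forall t, l (N t) = N (x :: t).
  move=> x.
  have [phi [phiP phiE]] := basis_lift eb idfun (fun i => N (x :: pbw_word i)).
  have [l lE] := linear_of_semilinear phiP; exists l => t; rewrite lE.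
  apply: (eq_solution (f := phi \o N) (g := fun t => N (x :: t)) _ _ _ t).
  - exact: (solution_map phiP (erefl c) (erefl (b2 c)) (erefl h) (erefl w) Ns).
  - exact: (solution_prefix [:: x] Ns).
  - by move=> i /=; rewrite Ne phiE.
pose L n := A (Lx n); pose W n := A (Wx n).
have actE x : act L W x = A x by case: x => [[] n].
have wactE t s : word_act L W t (N s) = N (t ++ s).
  by elim: t => //= x t; rewrite /word_act /= => ->; rewrite actE AE.
have nilp (x : int -> letter) : (forall n, mode (x n) = n) -> forall v,
    exists M : int, forall n, M < n -> A (x n) v = 0.
  move=> xE; apply: Nind => [|a u v [M HM] [M' HM']|t].
  - by exists 0 => n _; rewrite linear0.
  - exists (Num.max M M') => n; rewrite gt_max => /andP[Mn M'n].
    by rewrite linearP HM // HM' // scaler0 addr0.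
  exists (- deg t) => n tn; rewrite AE; apply: (solution_deg Ns [::]).
  by rewrite degE xE; lia.
have LN : L_truncated L by exact: (nilp Lx).
exists V, L, W, (N [::]); split.
- apply: bracket_rep => //; first exact/is_field_shift/(nilp Wx).
  move=> x y; rewrite !actE; apply: Nind => [|a u v Eu Ev|t].
  + rewrite !(linear0 (A _)) subrr bracket_eq0 // => t _ _.
    by rewrite (semilinear0 (word_act_semilinear L W t)).
  + have [M HM] := bounded_word_act W LN u; have [M' HM'] := bounded_word_act W LN v.
    rewrite !(linearP (A _)); transitivity (a *: bracket c (b2 c) (fun t => word_act L W t u) x y
      + bracket c (b2 c) (fun t => word_act L W t v) x y).
      by rewrite -Eu -Ev; lin_split R[i]; ring.
    rewrite -(bracket_linear _ _ _ _ _ HM HM').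
    by apply: eq_bracket => t _ _; rewrite (word_act_semilinear L W t).
  + rewrite !AE; have := solution_swap Ns [::] x y t => /= ->.
    by apply: eq_bracket => s _ _; rewrite wactE.
- split.
  + rewrite -pbw_word_empty Ne => e0.
    have := eb.1 [:: pbw_empty] (fun=> 1); rewrite big_seq1 e0 scaler0 => /(_ isT (erefl _)).
    by move=> /(_ pbw_empty (mem_head _ _)) /eqP; rewrite oner_eq0.
  + move=> n n0; rewrite /L AE; have := solution_end Ns [::] (x := Lx n) (ltW n0) => /= ->.
    by rewrite /chi /= gt_eqF // scale0r.
  + move=> n n0; rewrite /W AE; have := solution_end Ns [::] (x := Wx n) (ltW n0) => /= ->.
    by rewrite /chi /= gt_eqF // scale0r.
  + by rewrite /L AE; have := solution_end Ns [::] (x := Lx 0) (lexx 0) => /= ->.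
  + by rewrite /W AE; have := solution_end Ns [::] (x := Wx 0) (lexx 0) => /= ->.
- move=> S [S0 SD] SL SW SPsi; apply/seteqP; split=> // v _; move: v.
  apply: Nind => // t; elim: t => // -[[] n] t IH; rewrite -AE.
    exact: SW.
  exact: SL.
have -> : pbw_vector L W (N [::]) = e.
  by apply/funext => i; rewrite pbw_vectorE wactE cats0 Ne.
exact: eb.
Qed.

End VermaModules.

(** * The adjoint of a word, and the universal property of Verma representations *)

(** The anti-involution by which the operators of a word pass from one argument of
    an invariant form to the other. *)
Definition opp_letter (x : letter) : letter := (x.1, - mode x).
Definition adjoint (t : seq letter) : seq letter := rev (map opp_letter t).

Lemma opp_letterK : involutive opp_letter.
Proof. by case=> b n; rewrite /opp_letter /= opprK. Qed.

Lemma adjoint_cat s t : adjoint (s ++ t) = adjoint t ++ adjoint s.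
Proof. by rewrite /adjoint map_cat rev_cat. Qed.

Lemma adjoint_cons x t : adjoint (x :: t) = rcons (adjoint t) (opp_letter x).
Proof. by rewrite /adjoint /= rev_cons. Qed.

Lemma adjoint_rcons t x : adjoint (rcons t x) = opp_letter x :: adjoint t.
Proof. by rewrite -cats1 adjoint_cat. Qed.

Lemma adjointK : involutive adjoint.
Proof.
by move=> t; rewrite /adjoint map_rev revK -map_comp map_id_in // => x _; exact: opp_letterK.
Qed.

Lemma deg_adjoint t : deg (adjoint t) = - deg t.
Proof.
elim: t => [|x t IH]; first by rewrite deg_nil oppr0.
by rewrite adjoint_cons !degE IH /=; lia.
Qed.

Section AdjointBracket.
Variables (K : numFieldType) (c beta : K) (T : lmodType K) (G : seq letter -> T) (M : int).
Local Notation bracket := (bracket c beta).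
Hypothesis GM : bounded M G.
Hypothesis G_LL : forall a b : int,
  G [:: Lx a; Lx b] - G [:: Lx b; Lx a] = bracket G (Lx a) (Lx b).

(** Reversing the factors of the products moves the threshold of the normal
    ordering from [-1] to [2]. The commutators of the three terms concerned add
    up to a multiple of [L_(-N)], which compensates for the change of the linear
    term; their central parts cancel. *)
Lemma Lambda_adjoint (N : int) :
  Lambda_value (G \o adjoint) N = Lambda_value G (- N).
Proof.
pose P (k : int) := G [:: Lx (- N - k); Lx k]; pose Q (k : int) := G [:: Lx k; Lx (- N - k)].
have PM (k : int) : M < k -> P k = 0 by exact: GM.
have QM (k : int) : k < - N - M -> Q k = 0 by move=> kM; apply: GM; lia.
have E1 : isum (LL_term (G \o adjoint) N) = isum (cut P Q 2).
  rewrite -(isum_reflect 0 (cut P Q 2)); apply: eq_isum => k.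
  rewrite /LL_term /cut /P /Q /= /adjoint /opp_letter /= /rev /=.
  have -> : (2 <= 0 - k) = ~~ (-1 <= k) by lia.
  have -> : - N - (0 - k) = - (N - k) by lia.
  by rewrite sub0r; case: ifP.
pose H (k : int) : T := (2 * sum1 K k + (N * k)%:~R) *: G [:: Lx (- N)] +
  (c / 12 * (N == 0)%:R * (sum3 K k - sum1 K k)) *: G [::].
have E2 : isum (cut P Q 2) = isum (cut P Q (-1)) + (H 2 - H (-1)).
  have E (p : int) : isum (cut P Q p) = isum (fun k => (1 : K) *: cut P Q p k).
    by apply: eq_isum => k; rewrite scale1r.
  rewrite !E; apply: (isum_cut_shift PM QM) => k.
  rewrite /Q /P G_LL bracketLL coef1LL.
  have -> : k + (- N - k) = - N by lia.
  rewrite oppr_eq0 /H /sum1 /sum3.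
  by lin_split K; field.
rewrite /Lambda_value E1 E2 -/(LL_term G (- N)).
rewrite /= /adjoint /opp_letter /= /rev /= /H /sum1 /sum3.
have -> : isum (LL_term G (- N)) = isum (cut P Q (-1)) by [].
by rewrite -/(Lx (- N)); lin_split K; field.
Qed.

Lemma bracket_adjoint x y :
  bracket G (opp_letter y) (opp_letter x) = bracket (G \o adjoint) x y.
Proof.
rewrite /bracket /= -[- mode y - mode x]/(- mode y + - mode x).
have -> : - mode y + - mode x = - (mode x + mode y) by lia.
rewrite Lambda_adjoint; congr (_ *: _ + _ *: _ + _ *: _ + _ *: _).
- rewrite /coef1 /=; have -> : (- mode y + - mode x == 0) = (mode x + mode y == 0) by lia.
  case: (eqVneq (mode x + mode y) 0) => [xy|_]; last first.
    by case: x.1; case: y.1; rewrite ?mulr0.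
  have -> : mode y = - mode x by lia.
  by rewrite opprK; case: x.1; case: y.1.
- by rewrite /coefL /=; case: x.1; case: y.1 => //; field.
- by rewrite /coefW /=; case: x.1; case: y.1 => //; ring.
- by rewrite /coefLambda /= andbC; case: ifP => // _; ring.
Qed.
End AdjointBracket.

Section VermaTheory.
Variables (R : realType) (c h w : R[i]).
Local Notation beta := (b2 c).
Local Notation C := R[i].

Section OneModule.
Variables (V : lmodType C) (L W : int -> {linear V -> V}) (Psi : V).
Hypothesis verma : Verma_representation c h w L W Psi.
Local Notation ev := (fun t => word_act L W t Psi).

Lemma ev_solution : solution c beta h w ev.
Proof. by case: verma => rep lwv _ _; exact: word_act_solution. Qed.

Lemma ev_basis : is_basis (fun i => ev (pbw_word i)).
Proof.
case: verma => _ _ _; rewrite (_ : pbw_vector L W Psi = fun i => ev (pbw_word i)) //.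
by apply/funext => i; rewrite pbw_vectorE.
Qed.

Lemma eq_on_words (V' : lmodType C) (sigma : {rmorphism C -> C}) (phi psi : V -> V') :
  semilinear sigma phi -> semilinear sigma psi ->
  (forall t, phi (ev t) = psi (ev t)) -> phi =1 psi.
Proof. by move=> phiP psiP E; apply: (eq_semilinear ev_basis phiP psiP) => i. Qed.

(** The universal property: both [phi] composed with word evaluation and [f] are
    solutions, and they agree on PBW words by the choice of [phi]. *)
Lemma Verma_lift (V' : lmodType C) (sigma : {rmorphism C -> C}) (f : seq letter -> V') :
  sigma c = c -> sigma beta = beta -> sigma h = h -> sigma w = w ->
  solution c beta h w f ->
  exists phi : V -> V', semilinear sigma phi /\ forall t, phi (ev t) = f t.
Proof.
move=> sc sb sh sw fs; have [phi [phiP phiE]] := basis_lift ev_basis sigma (fun i => f (pbw_word i)).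
exists phi; split=> // t; apply: (eq_solution (f := phi \o ev) _ fs _ t) => //.
exact: (solution_map phiP sc sb sh sw ev_solution).
Qed.

End OneModule.

Theorem Verma_unique (V : lmodType C) (L W : int -> {linear V -> V}) (Psi : V)
    (V' : lmodType C) (L' W' : int -> {linear V' -> V'}) (Psi' : V') :
  Verma_representation c h w L W Psi -> Verma_representation c h w L' W' Psi' ->
  isomorphic L W Psi L' W' Psi'.
Proof.
move=> verma verma'.
have [phi0 [phi0P]] := Verma_lift verma (sigma := idfun) (erefl _) (erefl _) (erefl _) (erefl _)
  (ev_solution verma').
have [psi [psiP psiE]] := Verma_lift verma' (sigma := idfun) (erefl _) (erefl _) (erefl _) (erefl _)
  (ev_solution verma).
have [phi phiE0] := linear_of_semilinear phi0P; rewrite -(funext phiE0) => phiE.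
have phiP := semilinear_linear phi.
have phi_act (x : letter) v : phi (act L W x v) = act L' W' x (phi v).
  move: v; apply: (eq_on_words verma (sigma := idfun)).
  - exact: (semilinear_comp (semilinear_linear _) phiP).
  - exact: (semilinear_comp phiP (semilinear_linear _)).
  by move=> t; rewrite phiE -[act L W x _]/(word_act L W (x :: t) Psi) phiE.
exists phi; split.
- exists psi => v; move: v.
    apply: (eq_on_words verma (sigma := idfun)); first exact: (semilinear_comp phiP psiP).
      exact: (semilinear_linear idfun).
    by move=> t /=; rewrite phiE psiE.
  apply: (eq_on_words verma' (sigma := idfun)); first exact: (semilinear_comp psiP phiP).
    exact: (semilinear_linear idfun).
  by move=> t /=; rewrite psiE phiE.
- by move=> n v; exact: (phi_act (Lx n)).
- by move=> n v; exact: (phi_act (Wx n)).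
- exact: (phiE [::]).
Qed.

End VermaTheory.

(** * Invariant forms *)

Section VacuumFunctional.
Variables (K : numFieldType) (c beta h0 w0 : K).
Local Notation solution := (@solution K c beta h0 w0 _).
(** The coefficient of the lowest weight vector, as a solution with scalar
    values. *)
Variable omega : seq letter -> K^o.
Hypothesis omega_sol : solution omega.
Hypothesis omega_pbw : forall i, omega (pbw_word i) = (pbw_word i == [::])%:R.

(** The homogeneous part of degree 0 of [omega] is a solution with the same values
    on PBW words, since nonempty PBW words have negative degree. *)
Lemma omega_deg t : deg t != 0 -> omega t = 0.
Proof.
move=> t0; rewrite (eq_solution omega_sol (solution_homogeneous 0 omega_sol) _ t).
  by rewrite (negbTE t0).
move=> i; rewrite omega_pbw; case: ifP => [//|/eqP i0].
by case: eqP => // iE; rewrite iE deg_nil in i0.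
Qed.

(** [omega] is a lowest weight vector for the adjoint action. For positive mode
    this is a matter of degrees; for mode 0 both sides are solutions in [t] which
    agree on PBW words. *)
Lemma omega_head x t : 0 <= mode x ->
  omega (opp_letter x :: t) = chi h0 w0 x *: omega t.
Proof.
move=> x0; have [x00|xn0] := eqVneq (mode x) 0; last first.
  rewrite /chi (negbTE xn0) scale0r.
  have [t0|tn0] := eqVneq (deg t) (mode x); last first.
    by apply: omega_deg; rewrite degE /=; lia.
  by apply: (solution_deg omega_sol [:: _]); rewrite t0; lia.
have -> : opp_letter x = x by case: x x00 {x0} => b n /= ->; rewrite /opp_letter /= oppr0.
have scaleP : semilinear idfun ( *:%R (chi h0 w0 x) : K^o -> K^o).
  by move=> a u v; rewrite scalerDr !scalerA mulrC.
apply: (eq_solution (solution_prefix [:: x] omega_sol)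
  (solution_map scaleP (erefl c) (erefl beta) (erefl h0) (erefl w0) omega_sol) _ t).
move=> i /=; case: (eqVneq (pbw_word i) [::]) => [->|i0].
  by rewrite (solution_end omega_sol [::]).
have [_ /(_ i0) di] := deg_all_neg (all_neg_pbw_word i).
have d0 : deg (pbw_word i) != 0 by rewrite neq_lt di.
by rewrite (omega_deg d0) omega_deg ?scaler0 // degE x00 add0r.
Qed.

Lemma omega_adjoint_solution v : solution (fun u => omega (adjoint u ++ v)).
Proof.
apply: solutionI => [u x y t|u x x0]; last first.
  by rewrite adjoint_rcons /= omega_head.
rewrite !adjoint_cat !adjoint_cons -!cats1 -!catA /= (solution_swap omega_sol).
rewrite (bracket_adjoint (M := - deg (adjoint u ++ v))).
- apply: eq_bracket => s _ _; rewrite /= !adjoint_cat -!catA //.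
- move=> a b ab; have := solution_deg omega_sol (adjoint t ++ [:: Lx a]) (t := Lx b :: adjoint u ++ v).
  by rewrite -catA /=; apply; rewrite degE /=; lia.
by move=> a b; exact: (solution_swap omega_sol).
Qed.

Lemma omega_adjoint t : omega (adjoint t) = omega t.
Proof.
have := eq_solution (omega_adjoint_solution [::]) omega_sol _ t; rewrite cats0; apply=> i.
rewrite cats0; have [->//|i0] := eqVneq (pbw_word i) [::].
have [_ /(_ i0) di] := deg_all_neg (all_neg_pbw_word i).
have d0 : deg (pbw_word i) != 0 by rewrite neq_lt di.
by rewrite !omega_deg // deg_adjoint oppr_eq0.
Qed.

End VacuumFunctional.

Section Forms.
Variables (R : realType) (c h w : R[i]).
Local Notation beta := (b2 c).
Local Notation C := R[i].
Variables (V : lmodType C) (L W : int -> {linear V -> V}) (Psi : V).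
Hypothesis verma : Verma_representation c h w L W Psi.
Local Notation ev := (fun t => word_act L W t Psi).

Lemma omega_exists : exists omega : seq letter -> C^o,
  solution c beta h w omega /\
  forall i, omega (pbw_word i) = (pbw_word i == [::])%:R.
Proof.
have [phi [phiP phiE]] := basis_lift (ev_basis verma) idfun
  (fun i => (pbw_word i == [::])%:R : C^o).
exists (phi \o ev); split=> // .
exact: (solution_map phiP (erefl c) (erefl beta) (erefl h) (erefl w) (ev_solution verma)).
Qed.

Section SesquilinearForms.
Variable sigma : {rmorphism C -> C}.
Hypotheses (sc : sigma c = c) (sbeta : sigma beta = beta)
  (sh : sigma h = h) (sw : sigma w = w).
Variable omega : seq letter -> C^o.
Hypothesis omega_sol : solution c beta h w omega.
Hypothesis omega_pbw : forall i, omega (pbw_word i) = (pbw_word i == [::])%:R.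

(** Bilinear for [sigma] the identity, sesquilinear for [sigma] the complex
    conjugation. *)
Definition sesqui (f : V -> V -> C) :=
  (forall y, semilinear idfun (fun x => f x y : C^o)) /\
  (forall x, semilinear sigma (f x : V -> C^o)).

Lemma sesqui_eq f g : sesqui f -> sesqui g ->
  (forall u v, f (ev u) (ev v) = g (ev u) (ev v)) -> f =2 g.
Proof.
move=> [fl fr] [gl gr] fg x y; move: y; apply: (eq_on_words verma (fr x) (gr x)) => v.
by move: x; apply: (eq_on_words verma (fl _) (gl _)) => u.
Qed.

(** Moving the word [u] to the second argument leaves the function
    [t -> (Psi, t Psi)], which is a solution and vanishes on nonempty PBW words
    because their first letter, moved back, annihilates [Psi]. *)
Lemma form_on_words f : sesqui f -> invariant_form L W f -> f Psi Psi = 1 ->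
  forall u v, f (ev u) (ev v) = omega (adjoint u ++ v).
Proof.
move=> [fl fr] inv f1.
have inv' x p q : f (act L W x p) q = f p (act L W (opp_letter x) q).
  by case: x => [[] n]; case: (inv n p q).
have f0 q : f 0 q = 0 by apply: (semilinear0 (fl q)).
have fPsi : (fun t => f Psi (ev t) : C^o) =1 omega.
  apply: (eq_solution _ omega_sol).
    exact: (solution_map (fr Psi) sc sbeta sh sw (ev_solution verma)).
  move=> i; rewrite omega_pbw; case: (pbw_word i) (all_neg_pbw_word i) => //= x s /andP[x0 _].
  rewrite -[x in act L W x]opp_letterK -inv'.
  case: verma => _ [_ Lp Wp _ _] _ _.
  by case: x x0 => [[] n] /= n0; rewrite /act /= ?Lp ?Wp ?f0 // oppr_gt0.
elim=> [|x u IH] v; first exact: fPsi.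
by rewrite adjoint_cons cat_rcons -IH inv'.
Qed.

(** [l v] is the linear functional [(., v Psi)], obtained from the universal
    property; [f x] extends [v -> l v x] from PBW words. *)
Lemma form_exists : exists f : V -> V -> C,
  [/\ sesqui f, invariant_form L W f & f Psi Psi = 1].
Proof.
have /choice[l lP] : forall v : seq letter, exists phi : V -> C^o,
    semilinear idfun phi /\ forall u, phi (ev u) = omega (adjoint u ++ v).
  move=> v; apply: (Verma_lift verma) => //.
  exact: omega_adjoint_solution.
have /choice[f fP] : forall x : V, exists phi : V -> C^o,
    semilinear sigma phi /\ forall i, phi (ev (pbw_word i)) = l (pbw_word i) x.
  by move=> x; exact: (basis_lift (ev_basis verma)).
have fs : sesqui f.
  split=> [y|x]; last by have [] := fP x.
  move=> a u v; move: y.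
  have fr x : semilinear sigma (f x) by have [] := fP x.
  apply: (eq_semilinear (ev_basis verma) (fr _) (psi := fun y => a *: f u y + f v y)).
    move=> b p q; rewrite !fr; rewrite !scalerDr !scalerA.
    by rewrite [a * _]mulrC -!scalerA addrACA.
  by move=> i; rewrite !(fP _).2 (lP _).1.
have fE u v : f (ev u) (ev v) = omega (adjoint u ++ v).
  have := eq_solution (f := f (ev u) \o ev) (g := fun v => omega (adjoint u ++ v)) _ _ _ v.
  apply.
  - exact: (solution_map (fP _).1 sc sbeta sh sw (ev_solution verma)).
  - exact: solution_prefix.
  - by move=> i /=; rewrite (fP _).2 (lP _).2.
have inv' x p q : f (act L W x p) q = f p (act L W (opp_letter x) q).
  move: p q; apply: sesqui_eq; first last.
  - move=> u v; rewrite -[act L W x _]/(ev (x :: u)) -[act L W _ (ev v)]/(ev (opp_letter x :: v)).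
    by rewrite !fE adjoint_cons cat_rcons.
  - split=> [y a p q|p]; first exact: fs.1.
    exact: (semilinear_comp (semilinear_linear _) (fs.2 p)).
  - split=> [y|p]; last exact: fs.2.
    exact: (semilinear_comp (semilinear_linear _) (fs.1 y)).
exists f; split=> //.
  by move=> n x y; split; [exact: (inv' (Lx n))|exact: (inv' (Wx n))].
by have := fE [::] [::]; rewrite /= => ->; rewrite -pbw_word_empty omega_pbw.
Qed.

(** [omega] is fixed by [sigma] and by [adjoint]. *)
Lemma form_sigma_symmetric f : involutive sigma ->
  sesqui f -> invariant_form L W f -> f Psi Psi = 1 ->
  forall x y, f x y = sigma (f y x).
Proof.
move=> sigmaK fs inv f1.
have sigmaP : semilinear sigma (sigma : C^o -> C^o).
  by move=> a u v; rewrite rmorphD rmorphM.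
have omega_sigma t : sigma (omega t) = omega t.
  apply: (eq_solution (f := (sigma : C^o -> C^o) \o omega) _ omega_sol _ t).
    exact: (solution_map sigmaP).
  by move=> i /=; rewrite omega_pbw rmorph_nat.
apply: sesqui_eq => // [|u v].
  split=> [y a p q|x a p q]; first by rewrite fs.2 rmorphD rmorphM sigmaK.
  by rewrite fs.1 rmorphD rmorphM.
rewrite !(form_on_words fs inv f1) omega_sigma -(omega_adjoint omega_sol omega_pbw).
by rewrite adjoint_cat adjointK.
Qed.

End SesquilinearForms.
End Forms.

(** * The theorem *)

Unset Implicit Arguments.
Set Strict Implicit.

Lemma bilinear_of_sesqui (R : realType) (V : lmodType R[i]) (f : V -> V -> R[i]) :
  sesqui idfun f -> exists B : {bilinear V -> V -> R[i] | *%R & *%R}, B =2 f.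
Proof.
case=> fl fr.
have fP : bilinear_for *%R *%R f.
  by split=> [y a u v|x a u v]; [exact: fl|exact: fr].
pose B : {bilinear V -> V -> R[i] | *%R & *%R} :=
  HB.pack f (@bilinear_isBilinear.Build R[i] V V R[i] *%R *%R f fP).
by exists B.
Qed.

Lemma sesquilinear_of_sesqui (R : realType) (V : lmodType R[i]) (f : V -> V -> R[i]) :
  sesqui Num.conj f -> exists H : {sesquilinear_form V}, H =2 f.
Proof.
case=> fl fr.
have fP : bilinear_for *%R (Num.conj \; *%R) f.
  by split=> [y a u v|x a u v]; [exact: fl|exact: fr].
pose B : {sesquilinear_form V} :=
  HB.pack f (@bilinear_isBilinear.Build R[i] V V R[i] *%R (Num.conj \; *%R) f fP).
by exists B.
Qed.

Lemma sesqui_bilinear (R : realType) (V : lmodType R[i])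
  (B : {bilinear V -> V -> R[i] | *%R & *%R}) : sesqui idfun B.
Proof. by split=> [y a u v|x a u v]; rewrite ?linearPl ?linearPr. Qed.

Lemma sesqui_sesquilinear (R : realType) (V : lmodType R[i])
  (H : {sesquilinear_form V}) : sesqui Num.conj H.
Proof. by split=> [y a u v|x a u v]; rewrite ?linearPl ?linearPr. Qed.

Theorem propositionA3 (R : realType) (c h w : R[i]) (hc : c <> - (22 / 5)) :
  [/\ exists (V : lmodType R[i]) (L W : int -> {linear V -> V}) (Psi : V),
        Verma_representation c h w L W Psi,
      forall (V : lmodType R[i]) (L W : int -> {linear V -> V}) (Psi : V)
             (V' : lmodType R[i]) (L' W' : int -> {linear V' -> V'}) (Psi' : V'),
        Verma_representation c h w L W Psi ->
        Verma_representation c h w L' W' Psi' ->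
        isomorphic L W Psi L' W' Psi'
    & forall (V : lmodType R[i]) (L W : int -> {linear V -> V}) (Psi : V),
        Verma_representation c h w L W Psi ->
        (exists B : {bilinear V -> V -> R[i] | *%R & *%R},
           [/\ invariant_form L W B, B Psi Psi = 1,
               forall B' : {bilinear V -> V -> R[i] | *%R & *%R},
                 invariant_form L W B' -> B' Psi Psi = 1 -> B' =2 B
             & form_symmetric B]) /\
        (c \is Num.real -> h \is Num.real -> w \is Num.real ->
         exists H : {sesquilinear_form V},
           [/\ invariant_form L W H, H Psi Psi = 1,
               forall H' : {sesquilinear_form V},
                 invariant_form L W H' -> H' Psi Psi = 1 -> H' =2 H
             & form_hermitian H])].
Proof.
split; first exact: Verma_exists.
  by move=> V L W Psi V' L' W' Psi' verma verma'; exact: Verma_unique verma verma'.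
move=> V L W Psi verma.
have [omega [omega_sol omega_pbw]] := omega_exists verma.
(* Both kinds of forms are treated at once, with [sigma] the identity or the
   complex conjugation. *)
have forms (sigma : {rmorphism R[i] -> R[i]}) : involutive sigma ->
    sigma c = c -> sigma h = h -> sigma w = w ->
    exists f, [/\ sesqui sigma f, invariant_form L W f, f Psi Psi = 1,
      forall g, sesqui sigma g -> invariant_form L W g -> g Psi Psi = 1 -> g =2 f
      & forall x y, f x y = sigma (f y x)].
  move=> sK sc sh sw; have sb : sigma (b2 c) = b2 c.
    by rewrite /b2 fmorph_div (rmorphD _ 22) rmorphM !rmorph_nat sc.
  have [f [fs finv f1]] := form_exists verma sc sb sh sw omega_sol omega_pbw.
  have fE := form_on_words verma sc sb sh sw omega_sol omega_pbw fs finv f1.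
  exists f; split=> // [g gs ginv g1|].
    apply: (sesqui_eq verma gs fs) => u v.
    by rewrite fE (form_on_words verma sc sb sh sw omega_sol omega_pbw gs ginv g1).
  exact: (form_sigma_symmetric verma sc sb sh sw omega_sol omega_pbw sK).
split=> [|cR hR wR].
  have [f [fs finv f1 funiq fsym]] := forms idfun (fun=> erefl) (erefl c) (erefl h) (erefl w).
  have [B BE] := bilinear_of_sesqui _ _ _ fs; exists B.
  split=> [n x y||B' inv' B'1 x y|x y]; rewrite ?BE //.
  by rewrite (funiq _ (sesqui_bilinear _ _ B')).
have [f [fs finv f1 funiq fsym]] :=
  forms Num.conj (@conjCK _) (conj_Creal cR) (conj_Creal hR) (conj_Creal wR).
have [H HE] := sesquilinear_of_sesqui _ _ _ fs; exists H.
split=> [n x y||H' inv' H'1 x y|x y]; rewrite ?HE //.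
- by rewrite (funiq _ (sesqui_sesquilinear _ _ H')).
- exact: fsym.
Qed.
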